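(* Let $G_0$ be the group of real points of a linear algebraic group $\mathbf{G}_0$ defined over $\mathbb{Q}$, without nontrivial $\mathbb{Q}$-characters, let $\Gamma_0=\mathbf{G}_0(\mathbb{Z})$ be its integer points, let $a\in G_0$ be triangularizable with positive eigenvalues, and let $\mu$ be an $a$-invariant probability measure on $G_0/\Gamma_0$. Assume that $\mu$ is ergodic and non-concentrated. Let $I\subset G_0$ be a measurable fundamental domain for $\Gamma_0$ (acting by right multiplication), and denote by $\mathcal{L}$ the lift to $I$ of $\mu$. Let $E\subset I$ be a measurable subset of positive $\mathcal{L}$-measure. Define $$P_E=\Big\{\gamma\in\Gamma_0 : \mathcal{L}\Big(\bigcup_{k\in\mathbb{Z}} a^kE\gamma\cap E\Big)>0\Big\},$$ the set of elements of $\Gamma_0$ associated to return times in $E$. Then the smallest algebraic subgroup of $G_0$ containing $P_E$ is $G_0$.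
   Context: $a$ acts on $G_0/\Gamma_0$ by left multiplication. $\mathcal{L}$ is the measure on $I$ corresponding to $\mu$ under the bijection $I\to G_0/\Gamma_0$, $x\mapsto x\Gamma_0$ (equivalently, the restriction to $I$ of the right-$\Gamma_0$-invariant lift of $\mu$ to $G_0$). An element $a\in G_0-\{e\}$ is triangularizable with positive eigenvalues if for every finite-dimensional representation $\alpha$ of $\mathbf{G}_0$ defined over $\mathbb{Q}$, $\alpha(a)$ has only real, positive eigenvalues. An $a$-invariant ergodic probability measure $\mu$ on $G_0/\Gamma_0$ is non-concentrated if for every closed algebraic strict subgroup $H\subsetneq G_0$ containing $a$ and every $x\in G_0$ such that $Hx\Gamma_0$ is closed, one has $\mu(Hx\Gamma_0)<1$. *)

(* Defs.v *)
From HB Require Import structures.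
From mathcomp Require Import all_boot all_order all_algebra.
From mathcomp Require Import generic_quotient.
From mathcomp.real_closed Require Import complex.
From mathcomp Require mpoly.
From mathcomp Require Import all_classical all_reals all_analysis.
Import numFieldNormedType.Exports.

Set Implicit Arguments.
Unset Strict Implicit.
Unset Printing Implicit Defensive.

Import Order.TTheory GRing.Theory Num.Theory.

Local Open Scope classical_set_scope.
Local Open Scope ring_scope.

(* mpoly is not imported: its notations clash with those of analysis.
   [mxpoly K n] is K[x_(i,j)], the polynomials in the entries of an
   (n+1) x (n+1) matrix; the variable x_(i,j) is numbered [mxvec_index i j]. *)
Definition mxpoly (K : nzRingType) (n : nat) :=
  mpoly.mpoly (n.+1 * n.+1) K.

Definition evalQ (F : numFieldType) (n : nat) (p : mxpoly rat n)
    (g : 'M[F]_n.+1) : F :=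
  mpoly.mmap (@ratr F) (fun k => mxvec g 0 k) p.

Definition evalR (R : realType) (n : nat) (p : mxpoly R n)
    (g : 'M[R]_n.+1) : R :=
  mpoly.meval (fun k => mxvec g 0 k) p.

Definition GL_zeros (F : numFieldType) (n : nat) (S : set (mxpoly rat n)) :
    set 'M[F]_n.+1 :=
  [set g | g \is a GRing.unit /\ forall p, S p -> evalQ p g = 0].

(* A linear algebraic group defined over Q: a subgroup of GL_(n+1)(C) that is
   cut out by polynomials with rational coefficients.  It is not assumed to be
   connected. *)
Record Qgroup (R : realType) (n : nat) := {
  equations : set (mxpoly rat n) ;
  Qgroup1 : GL_zeros equations (1 : 'M[R[i]]_n.+1) ;
  QgroupM : forall g h : 'M[R[i]]_n.+1,
    GL_zeros equations g -> GL_zeros equations h -> GL_zeros equations (g * h) ;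
  QgroupV : forall g : 'M[R[i]]_n.+1,
    GL_zeros equations g -> GL_zeros equations (g^-1) }.

Definition cpoints (R : realType) (n : nat) (G : Qgroup R n) :
    set 'M[R[i]]_n.+1 := GL_zeros (equations G).

Definition rpoints_set (R : realType) (n : nat) (G : Qgroup R n) :
    set 'M[R]_n.+1 := GL_zeros (equations G).

Definition complexify (R : realType) (n : nat) (g : 'M[R]_n.+1) :
  'M[R[i]]_n.+1 := map_mx (real_complex R) g.

Section real_points_group.
Variables (R : realType) (n : nat) (G : Qgroup R n).
Implicit Types g h : 'M[R]_n.+1.

Lemma complexify_unit g :
  (complexify g \is a GRing.unit) = (g \is a GRing.unit).
Proof. exact: (map_unitmx (real_complex R) g). Qed.

Lemma complexifyV g : complexify g^-1 = (complexify g)^-1.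
Proof. exact: (map_invmx (real_complex R) g). Qed.

Lemma evalQ_complexify (p : mxpoly rat n) g :
  evalQ p (complexify g) = real_complex R (evalQ p g).
Proof.
rewrite /evalQ /mpoly.mmap rmorph_sum; apply: eq_bigr => m _.
rewrite rmorphM fmorph_rat /mpoly.mmap1 rmorph_prod; congr (_ * _).
by apply: eq_bigr => i _; rewrite rmorphXn /complexify -map_mxvec mxE.
Qed.

Lemma cpoints_complexify g : cpoints G (complexify g) <-> rpoints_set G g.
Proof.
rewrite /cpoints /rpoints_set /GL_zeros /= complexify_unit; split=> -[ug Sg].
  split=> // p /Sg; rewrite evalQ_complexify => /eqP.
  by rewrite fmorph_eq0 => /eqP.
by split=> // p /Sg pg; rewrite evalQ_complexify pg rmorph0.
Qed.

Lemma rpoints1 : rpoints_set G 1.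
Proof.
by apply/cpoints_complexify; rewrite /complexify map_mx1; exact: Qgroup1.
Qed.

Lemma rpointsM g h : rpoints_set G g -> rpoints_set G h -> rpoints_set G (g * h).
Proof.
move=> /cpoints_complexify Gg /cpoints_complexify Gh; apply/cpoints_complexify.
by rewrite /complexify map_mxM; exact: QgroupM.
Qed.

Lemma rpointsV g : rpoints_set G g -> rpoints_set G g^-1.
Proof.
move=> /cpoints_complexify Gg; apply/cpoints_complexify.
by rewrite complexifyV; exact: QgroupV.
Qed.

End real_points_group.

Definition rpoints (R : realType) (n : nat) (G : Qgroup R n) : Type :=
  set_type (rpoints_set G).

Section rpoints_instances.
Variables (R : realType) (n : nat) (G : Qgroup R n).
Implicit Types x y z : rpoints G.

HB.instance Definition _ :=
  Topological.copy (rpoints G) (set_type (rpoints_set G)).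

Definition mx_of x : 'M[R]_n.+1 := set_val x.

Definition rpoint (g : 'M[R]_n.+1) (Gg : rpoints_set G g) : rpoints G :=
  SigSub (mem_set Gg).

Lemma mx_ofP x : rpoints_set G (mx_of x).
Proof. exact: set_valP. Qed.

Lemma mx_of_inj : injective mx_of.
Proof. exact: val_inj. Qed.

Let one : rpoints G := rpoint (@rpoints1 R n G).
Let mul x y : rpoints G := rpoint (rpointsM (mx_ofP x) (mx_ofP y)).
Let inv x : rpoints G := rpoint (rpointsV (mx_ofP x)).

Let mulA : associative mul.
Proof. by move=> x y z; apply: mx_of_inj; exact: mulrA. Qed.
Let mul1 : left_id one mul.
Proof. by move=> x; apply: mx_of_inj; exact: mul1r. Qed.
Let mulr1' : right_id one mul.
Proof. by move=> x; apply: mx_of_inj; exact: mulr1. Qed.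
Let mulV : left_inverse one inv mul.
Proof. by move=> x; apply: mx_of_inj; apply: mulVr; case: (mx_ofP x). Qed.
Let mulV' : right_inverse one inv mul.
Proof. by move=> x; apply: mx_of_inj; apply: mulrV; case: (mx_ofP x). Qed.

HB.instance Definition _ := isPointed.Build (rpoints G) one.
HB.instance Definition _ :=
  isGroup.Build (rpoints G) mulA mul1 mulr1' mulV mulV'.

End rpoints_instances.

Definition zpow (gT : groupType) (a : gT) (k : int) : gT :=
  match k with Posz m => (a ^+ m)%g | Negz m => (a ^- m.+1)%g end.

Definition is_subgroup (gT : groupType) (H : set gT) : Prop :=
  [/\ H 1%g, (forall x y, H x -> H y -> H (x * y)%g)
    & forall x, H x -> H (x^-1)%g].

(* Zariski-closed subgroups of the real group G(R); the equations have real
   coefficients. *)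
Definition algebraic_subgroup (R : realType) (n : nat) (G : Qgroup R n)
    (H : set (rpoints G)) : Prop :=
  is_subgroup H /\
  exists S : set (mxpoly R n),
    H = [set x | forall p, S p -> evalR p (mx_of x) = 0].

(* G(Z) = G(R) `&` GL_(n+1)(Z) *)
Definition zpoints (R : realType) (n : nat) (G : Qgroup R n) :
    set (rpoints G) :=
  [set x | mx_of x \is a mxOver Num.int /\ (mx_of x)^-1 \is a mxOver Num.int].

Lemma zpoints_subgroup (R : realType) (n : nat) (G : Qgroup R n) :
  is_subgroup (@zpoints R n G).
Proof.
split.
- rewrite /zpoints/=; have -> : mx_of (1%g : rpoints G) = 1%:M by [].
  have Z1 : (1%:M : 'M[R]_n.+1) \is a mxOver Num.int.
    by apply: mxOver_scalar; [exact: rpred0|exact: rpred1].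
  by split; rewrite // (@invr1 'M[R]_n.+1).
- move=> x y [xZ xVZ] [yZ yVZ]; split; first exact: mxOverM.
  have -> : mx_of (x * y)%g = mx_of x * mx_of y by [].
  have ux : mx_of x \is a GRing.unit by case: (mx_ofP x).
  have uy : mx_of y \is a GRing.unit by case: (mx_ofP y).
  by rewrite invrM //; exact: mxOverM.
- move=> x [xZ xVZ]; split => //.
  have -> : mx_of (x^-1)%g = (mx_of x)^-1 by [].
  by rewrite invrK.
Qed.

(* Regular functions on G with rational coefficients: Q[x_(i,j), 1/det]
   restricted to G(C). *)
Definition Qregular (R : realType) (n : nat) (G : Qgroup R n)
    (f : 'M[R[i]]_n.+1 -> R[i]) : Prop :=
  exists (p : mxpoly rat n) (k : nat),
    forall g, cpoints G g -> f g = evalQ p g / (\det g) ^+ k.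

Definition Qcharacter (R : realType) (n : nat) (G : Qgroup R n)
    (chi : 'M[R[i]]_n.+1 -> R[i]) : Prop :=
  [/\ Qregular G chi,
      (forall g, cpoints G g -> chi g != 0)
    & forall g h, cpoints G g -> cpoints G h -> chi (g * h) = chi g * chi h].

Definition no_nontrivial_Qcharacter (R : realType) (n : nat)
    (G : Qgroup R n) : Prop :=
  forall chi, Qcharacter G chi -> forall g, cpoints G g -> chi g = 1.

Definition Qrepresentation (R : realType) (n : nat) (G : Qgroup R n) (m : nat)
    (alpha : 'M[R[i]]_n.+1 -> 'M[R[i]]_m) : Prop :=
  [/\ (forall i j, Qregular G (fun g => alpha g i j)),
      alpha 1 = 1%:M
    & forall g h, cpoints G g -> cpoints G h ->
        alpha (g * h) = alpha g *m alpha h].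

(* In the order of R[i], [0 < l] means that l is real and positive. *)
Definition triangularizable_pos (R : realType) (n : nat) (G : Qgroup R n)
    (a : rpoints G) : Prop :=
  a <> 1%g /\
  forall (m : nat) (alpha : 'M[R[i]]_n.+1 -> 'M[R[i]]_m),
    Qrepresentation G alpha ->
    forall l : R[i], eigenvalue (alpha (complexify (mx_of a))) l -> 0 < l.

Section quotient_by_integer_points.
Variables (R : realType) (n : nat) (G : Qgroup R n).
Local Open Scope quotient_scope.

Definition lcoset_rel (x y : rpoints G) : bool :=
  (x^-1 * y)%g \in zpoints (G := G).

Lemma lcoset_rel_refl : reflexive lcoset_rel.
Proof.
have [Z1 _ _] := @zpoints_subgroup R n G.
by move=> x; rewrite /lcoset_rel mulVg; exact: mem_set.
Qed.

Lemma lcoset_rel_sym : symmetric lcoset_rel.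
Proof.
have [_ _ ZV] := @zpoints_subgroup R n G.
suff sym x y : lcoset_rel x y -> lcoset_rel y x.
  by move=> x y; apply/idP/idP; exact: sym.
rewrite /lcoset_rel => /set_mem/ZV; rewrite invgM invgK.
exact: mem_set.
Qed.

Lemma lcoset_rel_trans : transitive lcoset_rel.
Proof.
have [_ ZM _] := @zpoints_subgroup R n G.
move=> y x z; rewrite /lcoset_rel => /set_mem xy /set_mem yz.
by apply: mem_set; move: (ZM _ _ xy yz); rewrite mulgA mulgK.
Qed.

Canonical lcoset_equiv :=
  EquivRel lcoset_rel lcoset_rel_refl lcoset_rel_sym lcoset_rel_trans.

(* G(R)/G(Z), with the quotient topology *)
Definition homspace : Type := quotient_topology {eq_quot lcoset_equiv}.

HB.instance Definition _ :=
  PointedTopological.copy homspace (quotient_topology {eq_quot lcoset_equiv}).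

Definition coset_pi (x : rpoints G) : homspace :=
  \pi_({eq_quot lcoset_equiv}) x.

Definition coset_repr (z : homspace) : rpoints G :=
  repr (z : {eq_quot lcoset_equiv}).

Lemma coset_piP x y : coset_pi x = coset_pi y <-> zpoints (x^-1 * y)%g.
Proof.
have E : reflect (coset_pi x = coset_pi y) (lcoset_rel x y).
  have <- : (\pi x == \pi y :> {eq_quot lcoset_equiv}) = lcoset_rel x y.
    exact: eqmodE.
  exact: (iffP eqP).
by split=> [/E/set_mem|/mem_set/E].
Qed.

Lemma coset_reprK : cancel coset_repr coset_pi.
Proof. exact: reprK. Qed.

Definition translate (a : rpoints G) (z : homspace) : homspace :=
  coset_pi (a * coset_repr z)%g.

Lemma translate_pi a x : translate a (coset_pi x) = coset_pi (a * x)%g.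
Proof.
apply/coset_piP; rewrite invgM -mulgA mulKg; apply/coset_piP.
exact: coset_reprK.
Qed.

End quotient_by_integer_points.

Notation borel T := (g_sigma_algebraType (@open T)).

Section dynamics.
Variables (R : realType) (n : nat) (G : Qgroup R n).
Variables (a : rpoints G) (mu : probability (borel (homspace G)) R).
Local Open Scope ereal_scope.

Definition invariant_measure : Prop :=
  forall A : set (borel (homspace G)), measurable A ->
    mu (translate a @^-1` A) = mu A.

Definition ergodic_measure : Prop :=
  forall A : set (borel (homspace G)), measurable A ->
    translate a @^-1` A = A -> mu A = 0 \/ mu A = 1.

(* [H x Gamma_0], as a subset of G(R)/G(Z) *)
Definition orbit_of (H : set (rpoints G)) (x : rpoints G) :
    set (homspace G) := [set coset_pi (h * x)%g | h in H].

Definition non_concentrated : Prop :=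
  forall H : set (rpoints G), algebraic_subgroup H -> H a -> H <> setT ->
  forall x : rpoints G, closed (orbit_of H x) -> mu (orbit_of H x) < 1.

Definition fundamental_domain (I : set (rpoints G)) : Prop :=
  measurable (I : set (borel (rpoints G))) /\
  forall x : rpoints G, exists! g, zpoints g /\ I (x * g)%g.

(* The lift of mu to I, extended by 0 outside I. *)
Definition lifted_measure (I : set (rpoints G)) (B : set (rpoints G)) : \bar R :=
  mu (@coset_pi R n G @` (B `&` I)).

Definition return_elements (I E : set (rpoints G)) : set (rpoints G) :=
  [set g | zpoints g /\
    0 < lifted_measure I (\bigcup_(k : int)
          ([set (zpow a k * x * g)%g | x in E] `&` E))].

End dynamics.

(* Main.v *)
Require Import Defs.
From mathcomp Require Import all_boot all_order all_algebra.
From mathcomp.real_closed Require Import complex.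
From mathcomp Require mpoly.
From mathcomp Require Import all_classical all_reals all_analysis.
From mathcomp Require Import ring lra.
Import Order.TTheory GRing.Theory Num.Theory.
Import numFieldNormedType.Exports.

(** Let [H] be an algebraic subgroup containing the return elements, [Gamma]
    the group of integer points, and suppose that [H] is not the whole group.

    The group [P = H `&` Gamma] consists of integer matrices, and an equation
    of [H] vanishes on [P] but not everywhere.  Chevalley's construction then
    gives finitely many polynomial functions [f i] with integral values on
    integral matrices that are constant on [P] but not on the group, and such
    that [f] behaves as an orbit map [g |-> w g]: equality of all [f i g] and
    [f i h] persists after right multiplication ([separating_invariants]).
    Here [w] is the exterior product of a maximal independent family of vectors
    [u t], [t] in [P], where [u] maps a matrix to its monomials; [P] multiplies
    [w] by a determinant, which is a sign because [P] preserves integrality.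
    The [f i] are the products of two Pluecker coordinates, so the sign
    disappears.

    The map [x |-> f (x^-1)] is therefore right [P]-invariant.  Almost every
    [x] in [E] returns to [E] only through elements of [P] ([null_bad]), so on
    the part of the quotient covered by [E] this map is well defined, and
    equivariant for [a].  By Poincare recurrence, almost every [x] in [E] comes
    back arbitrarily close to itself under negative powers of [a]
    ([poincare_recurrence]), hence [k |-> f (x^-1 a^k)] comes back arbitrarily
    close to each of its values.  But this sequence is an exponential polynomial
    with positive bases, as the eigenvalues of [a] are positive; it is
    eventually monotone ([posrec_sign]) and, being recurrent, constant
    ([posrec_recurrent]).  So [f (x^-1)] is [a]-invariant ([good_point_fixed]),
    and by ergodicity it is almost everywhere equal to one value [f (x0^-1)]
    ([F_essentially_constant]).

    This says that almost every point lies in the orbit through [x0] of the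
    stabilizer [H1] of [f (x0^-1)], an algebraic subgroup which contains [a].
    The orbit is closed because [f] takes integral, hence discrete, values on
    [Gamma] ([closed_orbit_conj_stabilizer]).  As [mu] is non-concentrated, [H1]
    is the whole group, and then [f] is constant: a contradiction. *)

Set Implicit Arguments.
Unset Strict Implicit.
Unset Printing Implicit Defensive.

Local Open Scope classical_set_scope.

(** * Polynomial functions of a matrix *)

Section PolynomialFunctions.
Variables (R : realType) (n : nat).
Local Open Scope ring_scope.
Import (canonicals) mpoly.

(** An inductive presentation of the functions [evalR p], which turns the
    stability properties used below into inductions. *)
Inductive polyfun : ('M[R]_n.+1 -> R) -> Prop :=
| polyfun_cst c : polyfun (fun=> c)
| polyfun_entry i j : polyfun (fun g => g i j)
| polyfunD p q : polyfun p -> polyfun q -> polyfun (fun g => p g + q g)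
| polyfunM p q : polyfun p -> polyfun q -> polyfun (fun g => p g * q g).

Lemma polyfun_sum (I : Type) (s : seq I) (P : pred I)
    (F : I -> 'M[R]_n.+1 -> R) :
  (forall i, polyfun (F i)) -> polyfun (fun g => \sum_(i <- s | P i) F i g).
Proof.
move=> FP; elim: s => [|i s IHs].
  by under eq_fun do rewrite big_nil; exact: polyfun_cst.
under eq_fun do rewrite big_cons; case: (P i) => //; exact: polyfunD.
Qed.

Lemma polyfun_prod (I : Type) (s : seq I) (P : pred I)
    (F : I -> 'M[R]_n.+1 -> R) :
  (forall i, polyfun (F i)) -> polyfun (fun g => \prod_(i <- s | P i) F i g).
Proof.
move=> FP; elim: s => [|i s IHs].
  by under eq_fun do rewrite big_nil; exact: polyfun_cst.
under eq_fun do rewrite big_cons; case: (P i) => //; exact: polyfunM.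
Qed.

Lemma polyfun_det (r : nat) (B : 'M[R]_n.+1 -> 'M[R]_r) :
  (forall i j, polyfun (fun g => B g i j)) -> polyfun (fun g => \det (B g)).
Proof.
move=> BP; apply: polyfun_sum => s; apply: polyfunM; first exact: polyfun_cst.
by apply: polyfun_prod.
Qed.

Lemma polyfun_translate (x y : 'M[R]_n.+1) q :
  polyfun q -> polyfun (fun g => q (x * g * y)).
Proof.
elim=> {q} [c|i j|p q _ IHp _ IHq|p q _ IHp _ IHq].
- exact: polyfun_cst.
- under eq_fun do rewrite mxE; apply: polyfun_sum => k.
  apply: polyfunM; last exact: polyfun_cst.
  under eq_fun do rewrite mxE; apply: polyfun_sum => l.
  by apply: polyfunM; [exact: polyfun_cst|exact: polyfun_entry].
- exact: polyfunD.
- exact: polyfunM.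
Qed.

Lemma polyfun_evalR (p : mxpoly R n) : polyfun (evalR p).
Proof.
rewrite (_ : evalR p = fun g => evalR p g) //.
under eq_fun do rewrite /evalR mpoly.mevalE.
apply: polyfun_sum => m; apply: polyfunM; first exact: polyfun_cst.
apply: polyfun_prod => k; case/mxvec_indexP: k => i j.
under eq_fun do rewrite mxvecE.
elim: (mpoly.fun_of_multinom _ _) => [|e IHe]; first exact: polyfun_cst.
by under eq_fun do rewrite exprS; apply: polyfunM => //; exact: polyfun_entry.
Qed.

Lemma polyfun_evalR_ex q :
  polyfun q -> exists p : mxpoly R n, forall g, evalR p g = q g.
Proof.
elim=> {q} [c|i j|p q _ [p' Ep] _ [q' Eq]|p q _ [p' Ep] _ [q' Eq]].
- by exists (mpoly.mpolyC _ c) => g; rewrite /evalR mpoly.mevalC.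
- exists (mpoly.mpolyX _ (mpoly.mnm1 (mxvec_index i j))) => g.
  by rewrite /evalR mpoly.mevalXU mxvecE.
- by exists ((p' : mpoly.mpoly _ R) + q') => g; rewrite -Ep -Eq /evalR mpoly.mevalD.
- by exists ((p' : mpoly.mpoly _ R) * q') => g; rewrite -Ep -Eq /evalR mpoly.mevalM.
Qed.

End PolynomialFunctions.

(** * Exponential polynomials with positive bases *)

Section PositiveRecurrences.
Variable R : realType.
Local Open Scope ring_scope.
Implicit Type h : nat -> R.

(** Sequences annihilated by a product of operators [S - l], where [S] is the
    shift and every [l] is positive.  They are the combinations of the sequences
    [k ^ e * l ^ k] with [0 < l]. *)
Inductive posrec : (nat -> R) -> Prop :=
| posrec0 : posrec (fun=> 0)
| posrec_step l h :
    0 < l -> posrec (fun k => h k.+1 - l * h k) -> posrec h.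

Lemma posrec_lin (b c : R) h :
  posrec h -> posrec (fun k => b * h k.+1 + c * h k).
Proof.
elim=> {h} [|l h l0 _ IH].
  by under eq_fun do rewrite !mulr0 addr0; exact: posrec0.
apply: (posrec_step l0); congr posrec: IH; apply/funext => k /=; ring.
Qed.

Lemma posrecZ (c : R) h : posrec h -> posrec (fun k => c * h k).
Proof.
by move=> /(posrec_lin 0 c); under eq_fun do rewrite mul0r add0r.
Qed.

Lemma posrecD h1 h2 : posrec h1 -> posrec h2 -> posrec (fun k => h1 k + h2 k).
Proof.
move=> L1; elim: L1 h2 => {h1} [|l h1 l0 _ IH] h2 L2.
  by under eq_fun do rewrite add0r.
apply: (posrec_step l0).
have /IH : posrec (fun k => h2 k.+1 - l * h2 k).
  have := posrec_lin 1 (- l) L2.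
  by under eq_fun do rewrite mul1r mulNr.
by move=> H; congr posrec: H; apply/funext => k /=; ring.
Qed.

(** If [D_l h] denotes [S h - l h], then [D_(l m) (h1 h2)] is
    [l h1 (D_m h2) + m (D_l h1) h2 + (D_l h1) (D_m h2)], and each of these
    products needs fewer annihilating factors than [h1 h2]. *)
Lemma posrecM h1 h2 : posrec h1 -> posrec h2 -> posrec (fun k => h1 k * h2 k).
Proof.
move=> L1; elim: L1 h2 => {h1} [|l h1 l0 L1 IH1] h2.
  by move=> _; under eq_fun do rewrite mul0r; exact: posrec0.
elim=> {h2} [|m h2 m0 L2 IH2].
  by under eq_fun do rewrite mulr0; exact: posrec0.
apply: (@posrec_step (l * m)); first exact: mulr_gt0.
have H1 := IH1 _ (posrec_step m0 L2).
have H2 := IH1 _ L2.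
have := posrecD (posrecD (posrecZ l IH2) (posrecZ m H1)) H2.
by move=> H; congr posrec: H; apply/funext => k /=; ring.
Qed.

Lemma posrec_cst (c : R) : posrec (fun=> c).
Proof.
apply: (posrec_step ltr01); under eq_fun do rewrite mul1r subrr.
exact: posrec0.
Qed.

(** A discrete form of Rolle's theorem: as [S h - l h] has eventually a constant
    sign, the sequence [h k / l ^ k] is eventually monotone. *)
Lemma posrec_sign h : posrec h ->
  exists N, (forall k, (N <= k)%N -> 0 <= h k) \/
            (forall k, (N <= k)%N -> h k <= 0).
Proof.
have grow l h1 N : 0 < l -> (forall k, (N <= k)%N -> 0 <= h1 k.+1 - l * h1 k) ->
    exists M, (forall k, (M <= k)%N -> 0 <= h1 k) \/
              (forall k, (M <= k)%N -> h1 k <= 0).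
  move=> l0 Hh; have [[M NM HM]|none] :=
    pselect (exists2 M, (N <= M)%N & 0 <= h1 M).
    exists M; left=> k /subnKC <-; elim: (k - M)%N => [|d IHd].
      by rewrite addn0.
    have := Hh (M + d)%N (leq_trans NM (leq_addr _ _)).
    rewrite addnS subr_ge0; apply: le_trans; exact: mulr_ge0 (ltW l0) IHd.
  exists N; right=> k Nk; rewrite leNgt; apply/negP => hk.
  by apply: none; exists k => //; exact: ltW.
elim=> {h} [|l h l0 _ [N [Hp|Hn]]]; first by exists 0%N; left.
  exact: grow l0 Hp.
have [|M [H|H]] := @grow l (fun k => - h k) N l0.
- by move=> k /Hn Hk; rewrite mulrN opprK addrC subr_ge0 -subr_le0.
- by exists M; right=> k /H; rewrite oppr_ge0.
- by exists M; left=> k /H; rewrite oppr_le0.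
Qed.

(** The differences [h k.+1 - h k] also satisfy a recurrence, so [h] is
    eventually monotone; being recurrent, it then tends to each of its values. *)
Lemma posrec_recurrent h : posrec h ->
  (forall m N (e : R), 0 < e ->
     exists2 k, (N <= k)%N & `|h (k + m)%N - h m| < e) ->
  forall m m', h m = h m'.
Proof.
have main h1 N : (forall k, (N <= k)%N -> 0 <= h1 k.+1 - h1 k) ->
    (forall m N (e : R), 0 < e ->
      exists2 k, (N <= k)%N & `|h1 (k + m)%N - h1 m| < e) ->
    forall m m', h1 m <= h1 m'.
  move=> mono rec m m'; rewrite leNgt; apply/negP => lt_mm.
  have homo k d : (N <= k)%N -> h1 k <= h1 (k + d)%N.
    move=> Nk; elim: d => [|d]; first by rewrite addn0.
    move=> /le_trans; apply; rewrite addnS -subr_ge0; apply: mono.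
    exact: leq_trans (leq_addr _ _).
  pose e := (h1 m - h1 m') / 2.
  have e0 : 0 < e by rewrite divr_gt0 // subr_gt0.
  have [k Nk km] := rec m N e e0.
  have [k' kk' km'] := rec m' (k + m)%N e e0.
  have := homo (k + m)%N (k' + m' - (k + m))%N (leq_trans Nk (leq_addr _ _)).
  rewrite subnKC ?(leq_trans kk' (leq_addr _ _)) //.
  move: km km'; rewrite !ltr_norml /e => /andP[k1 k2] /andP[k3 k4]; lra.
move=> Lh rec m m'.
have Ld : posrec (fun k => h k.+1 - h k).
  have := posrec_lin 1 (-1) Lh.
  by under eq_fun do rewrite mul1r mulN1r.
have [N [Hp|Hn]] := posrec_sign Ld.
  by apply/eqP; rewrite eq_le !(main h N).
have mainN := main (fun k => - h k) N.
apply/eqP; rewrite eq_le -lerN2 -[h m' <= _]lerN2 !mainN //.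
- by move=> k /Hn Hk; lra.
- move=> m1 N1 e e0; have [k ? ?] := rec m1 N1 e e0.
  by exists k => //; rewrite -opprD normrN.
- by move=> k /Hn Hk; lra.
- move=> m1 N1 e e0; have [k ? ?] := rec m1 N1 e e0.
  by exists k => //; rewrite -opprD normrN.
Qed.

Variables (n : nat) (a : 'M[R]_n.+1).
Hypothesis a_pos : forall l : R[i], eigenvalue (complexify a) l -> 0 < l.

(** Cayley-Hamilton over [R[i]]; the roots are positive, hence real. *)
Lemma pos_eigenvalues_annihilator :
  exists2 s : seq R, {in s, forall l, 0 < l} & \prod_(l <- s) (a - l%:M) = 0.
Proof.
have [rs Ers] := closed_field_poly_normal (char_poly (complexify a)).
have /monicP lc := char_poly_monic (complexify a).
move: Ers; rewrite lc scale1r => Ers.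
have rs_pos (l : R[i]) : l \in rs -> 0 < l.
  move=> lrs; apply: a_pos; rewrite eigenvalue_root_char Ers.
  by rewrite root_prod_XsubC.
exists [seq complex.Re l | l <- rs].
  by move=> _ /mapP[l /rs_pos + ->]; rewrite ltcE /= => /andP[].
apply: (map_mx_inj (f := real_complex R)).
have := Cayley_Hamilton (complexify a); rewrite Ers rmorph_prod /= map_mx0.
move=> <-; rewrite big_map rmorph_prod /=; apply: eq_big_seq => l lrs.
rewrite [RHS]rmorphB /= horner_mx_X horner_mx_C map_mxB map_scalar_mx /=.
congr (_ - _%:M); move: (rs_pos l lrs); rewrite ltcE /= => /andP[/eqP Im0 _].
by apply/eqP; rewrite eq_complex /= Im0 !eqxx.
Qed.

Lemma posrec_polyfun (x : 'M[R]_n.+1) q :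
  polyfun q -> posrec (fun k => q (x * a ^+ k)).
Proof.
have [s s_pos as0] := pos_eigenvalues_annihilator.
have entry i j (M : 'M[R]_n.+1) : \prod_(l <- s) (a - l%:M) * M = 0 ->
    posrec (fun k => (x * a ^+ k * M) i j).
  elim/last_ind: s s_pos M {as0} => [|s l IHs] s_pos M.
    rewrite big_nil mul1r => ->.
    by under eq_fun do rewrite mulr0 mxE; exact: posrec0.
  rewrite big_rcons /= -mulrA => /IHs H.
  have l0 : 0 < l by apply: s_pos; rewrite mem_rcons mem_head.
  apply: (posrec_step l0).
  have {}H : posrec (fun k => (x * a ^+ k * ((a - l%:M) * M)) i j).
    by apply: H => l' l's; apply: s_pos; rewrite mem_rcons inE l's orbT.
  congr posrec: H; apply/funext => k.
  rewrite mulrBl mulrBr exprSr !mulrA.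
  have -> : x * a ^+ k * l%:M = l *: (x * a ^+ k) by exact: mul_mx_scalar.
  by rewrite -scalerAl [LHS]mxE; congr (_ + _);
    rewrite [LHS]mxE; congr (- _); rewrite [LHS]mxE.
elim=> {q} [c|i j|p q _ IHp _ IHq|p q _ IHp _ IHq].
- exact: posrec_cst.
- have := @entry i j 1; rewrite as0 mul0r => /(_ erefl).
  by under eq_fun do rewrite mulr1.
- exact: posrecD.
- exact: posrecM.
Qed.

End PositiveRecurrences.

(** * Chevalley's construction for groups of integer matrices *)

Section SeparatingInvariants.
Variables (R : realType) (n : nat).
Local Open Scope ring_scope.
Implicit Types x y g : 'M[R]_n.+1.

(** A right-invariant finite-dimensional space of functions that contains [q],
    in coordinates.  With finite types as index sets, sums and products of
    functions correspond to sums and products of index sets. *)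
Let linearizable (q : 'M[R]_n.+1 -> R) :=
  exists (I : finType) (u : 'M[R]_n.+1 -> I -> R)
    (rho : 'M[R]_n.+1 -> I -> I -> R) (c : I -> R),
  [/\ forall i, polyfun (u^~ i),
      forall g i, g \is a mxOver Num.int -> u g i \is a Num.int,
      forall y x i, u (y * x) i = \sum_j u y j * rho x j i
    & forall y, q y = \sum_i u y i * c i].

Let linearizableD p q :
  linearizable p -> linearizable q -> linearizable (fun g => p g + q g).
Proof.
move=> [I [u [rho [c [uP uZ uM uE]]]]] [J [v [tau [d [vP vZ vM vE]]]]].
exists (I + J)%type.
exists (fun g k => match k with inl i => u g i | inr j => v g j end).
exists (fun g k l => match k, l with
  inl i, inl i' => rho g i i' | inr j, inr j' => tau g j j' | _, _ => 0 end).
exists (fun k => match k with inl i => c i | inr j => d j end).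
split=> [[i|j]|g [i|j]|y x [i|j]|y] //=; rewrite ?big_sumType /=.
- exact: uZ.
- exact: vZ.
- by rewrite [X in _ + X]big1 ?addr0 // => k _; rewrite mulr0.
- by rewrite [X in X + _]big1 ?add0r // => k _; rewrite mulr0.
- by rewrite uE vE.
Qed.

Let linearizableM p q :
  linearizable p -> linearizable q -> linearizable (fun g => p g * q g).
Proof.
move=> [I [u [rho [c [uP uZ uM uE]]]]] [J [v [tau [d [vP vZ vM vE]]]]].
exists (I * J)%type; exists (fun g k => u g k.1 * v g k.2).
exists (fun g k l => rho g k.1 l.1 * tau g k.2 l.2).
exists (fun k => c k.1 * d k.2).
split=> [k|g k gZ|y x k|y] /=.
- exact: polyfunM.
- by rewrite rpredM // ?uZ ?vZ.
- rewrite uM vM big_distrlr pair_bigA /=; apply: eq_bigr => l _; ring.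
- rewrite uE vE big_distrlr pair_bigA /=; apply: eq_bigr => l _; ring.
Qed.

(** The translates of a polynomial function span a finite-dimensional space.
    The spanning functions [u] can be taken to be monomials, so they have
    integral values on integral matrices. *)
Lemma polyfun_linearize q : polyfun q ->
  exists (N : nat) (u : 'M[R]_n.+1 -> 'rV[R]_N)
    (rho : 'M[R]_n.+1 -> 'M[R]_N) (c : 'cV[R]_N),
  [/\ forall k, polyfun (fun g => u g 0 k),
      forall g, g \is a mxOver Num.int -> u g \is a mxOver Num.int,
      forall y x, u (y * x) = u y *m rho x
    & forall y, q y = (u y *m c) 0 0].
Proof.
move=> qP; have [I [u [rho [c [uP uZ uM uE]]]]] : linearizable q.
  elim: qP => {q} [c|i j|p q _ IHp _ IHq|p q _ IHp _ IHq].
  - exists unit, (fun _ _ => 1), (fun _ _ _ => 1), (fun=> c).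
    split=> [_|g _ _|y x _|y]; rewrite ?rpred1 ?big_const ?card_unit //=.
    + exact: polyfun_cst.
    + by rewrite mulr1 addr0.
    + by rewrite mul1r addr0.
  - exists 'I_n.+1, (fun g k => g i k), (fun g k l => g k l).
    exists (fun k => (k == j)%:R); split=> [k|g k /mxOverP|y x k|y] //.
    + exact: polyfun_entry.
    + by rewrite mxE.
    + rewrite (bigD1 j) //= eqxx mulr1 big1 ?addr0 // => k /negbTE ->.
      by rewrite mulr0.
  - exact: linearizableD.
  - exact: linearizableM.
exists #|I|, (fun g => \row_k u g (enum_val k)).
exists (fun g => \matrix_(k, l) rho g (enum_val k) (enum_val l)).
exists (\col_k c (enum_val k)); split=> [k|g gZ|y x|y].
- by under eq_fun do rewrite mxE.
- by apply/mxOverP => i j; rewrite mxE uZ.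
- apply/rowP => k; rewrite !mxE uM.
  by rewrite [LHS](big_enum_val (A := I)) /=; apply: eq_bigr => l _; rewrite !mxE.
- rewrite uE mxE [LHS](big_enum_val (A := I)) /=.
  by apply: eq_bigr => l _; rewrite !mxE.
Qed.

(** A form of the Cauchy-Binet formula in which the columns are chosen by
    arbitrary functions; those that are not injective contribute zero. *)
Lemma det_mulmx_minors (r N : nat) (B : 'M[R]_(r, N)) (C : 'M[R]_(N, r)) :
  \det (B *m C) =
  \sum_(K : {ffun 'I_r -> 'I_N}) \det (colsub K B) * \prod_j C (K j) j.
Proof.
rewrite -det_tr /determinant.
under eq_bigr => s _.
  under eq_bigr do rewrite !mxE.
  rewrite bigA_distr_bigA /= big_distrr /=.
  over.
rewrite exchange_big /=; apply: eq_bigr => K _; rewrite -[X in X * _]det_tr.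
rewrite /determinant big_distrl; apply: eq_bigr => s _ /=.
by rewrite big_split mulrA; congr (_ * _ * _); apply: eq_bigr => j _; rewrite !mxE.
Qed.

Lemma maximal_free_rows (T : Type) (N : nat) (P : set T) (u : T -> 'rV[R]_N) :
  exists (r : nat) (t : 'I_r -> T),
  [/\ forall j, P (t j), row_free (\matrix_j u (t j))
    & forall z, P z -> (u z <= \matrix_j u (t j))%MS].
Proof.
pose Q r := `[< exists t : 'I_r -> T,
  (forall j, P (t j)) /\ row_free (\matrix_j u (t j)) >].
have Q0 : exists r, Q r.
  have t0 : 'I_0 -> T by case.
  exists 0%N; apply/asboolP; exists t0.
  by split=> [[]//|]; rewrite -row_leq_rank.
have QN r : Q r -> (r <= N)%N.
  by move=> /asboolP[t [_ /eqP <-]]; exact: rank_leq_col.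
case: (ex_maxnP Q0 QN) => r /asboolP[t [tP free]] max_r.
exists r, t; split=> // z Pz; apply/negP => /negP uz.
suff /max_r : Q r.+1 by rewrite ltnn.
apply/asboolP; exists (fun j => if unlift ord0 j is Some i then t i else z).
split=> [j|]; first by case: unliftP.
move: free uz; set B := (\matrix_j u (t j)) => free uz.
have -> : \matrix_j u (if unlift ord0 j is Some i then t i else z) =
    col_mx (u z) B :> 'M[R]_(1 + r, N).
  apply/row_matrixP => j; rewrite rowK; case: (unliftP ord0 j) => [i|] ->.
    have -> : lift ord0 i = rshift 1 i by apply: val_inj.
    by rewrite rowKd rowK.
  have -> : ord0 = lshift r ord0 :> 'I_(1 + r) by apply: val_inj.
  by rewrite rowKu; apply/rowP => k; rewrite mxE.
have rankE : \rank (col_mx (u z) B) = \rank (u z + B)%MS by rewrite addsmxE.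
rewrite -row_leq_rank rankE -[X in (X < _)%N](eqP free).
rewrite (ltn_leqif (mxrank_leqif_sup (addsmxSr _ _))).
by rewrite addsmx_sub negb_and uz.
Qed.

Lemma det_int (r : nat) (A : 'M[R]_r) :
  A \is a mxOver Num.int -> \det A \is a Num.int.
Proof.
move=> /mxOverP AZ; rewrite rpred_sum // => s _.
by rewrite rpredM ?rpred_prod // rpredX // rpredN rpred1.
Qed.

(** Otherwise the nonzero integers [e ^+ m * d] would tend to [0]. *)
Lemma norm_ge1_of_integral_orbit (e d : R) : e != 0 -> d != 0 ->
  (forall m : nat, e ^+ m * d \is a Num.int) -> 1 <= `|e|.
Proof.
move=> e0 d0 eZ; rewrite leNgt; apply/negP => e1.
have /cvgr0Pnorm_lt/(_ `|d|^-1) : (fun m => e ^+ m) @ \oo --> (0 : R).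
  exact: cvg_expr.
rewrite invr_gt0 normr_gt0 => /(_ d0) [m _ /(_ m (leqnn m))] /=.
rewrite -[X in _ < X]mul1r ltr_pdivlMr ?normr_gt0 // -normrM; apply/negP.
rewrite -leNgt norm_intr_ge1 //.
by rewrite mulf_neq0 // expf_neq0.
Qed.

(** The vectors [u t], [t] in [P], span a space [V] that is stable under [P],
    and [q g0 != 0] prevents [g0] from preserving it.  The functions [f] are
    the pairwise products of the maximal minors of [B g], whose rows are a basis
    of [V] translated by [g].  For [x] in [P] these minors get multiplied by a
    determinant, which is a sign since the powers of [x] and of [x^-1] give
    integral minors. *)
Lemma separating_invariants (P : set 'M[R]_n.+1) (q : 'M[R]_n.+1 -> R) g0 :
  P 1 -> (forall x y, P x -> P y -> P (x * y)) ->
  (forall x, P x -> [/\ x \is a GRing.unit, x \is a mxOver Num.int & P x^-1]) ->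
  polyfun q -> (forall x, P x -> q x = 0) -> q g0 != 0 ->
  exists (I : finType) (f : I -> 'M[R]_n.+1 -> R),
  [/\ forall i, polyfun (f i),
      forall i g, g \is a mxOver Num.int -> f i g \is a Num.int,
      forall g h, (forall i, f i g = f i h) ->
        forall x i, f i (g * x) = f i (h * x),
      forall x i, P x -> f i x = f i 1
    & ~ forall i, f i g0 = f i 1].
Proof.
move=> P1 PM PV /polyfun_linearize[N [u [rho [c [uP uZ uM uE]]]]] qP qg0.
have [r [t [tP free span]]] := maximal_free_rows P u.
pose B x : 'M[R]_(r, N) := \matrix_j u (t j * x).
have BM x y : B (x * y) = B x *m rho y.
  by apply/row_matrixP => j; rewrite row_mul !rowK mulrA uM.
have B1 : B 1 = \matrix_j u (t j).
  by apply/row_matrixP => j; rewrite !rowK mulr1.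
rewrite -B1 in free span.
have BP x : P x -> exists A : 'M[R]_r, forall y, B (x * y) = A *m B y.
  move=> Px; have /submxP[A BA] : (B x <= B 1)%MS.
    by apply/row_subP => j; rewrite rowK; apply: span; exact: PM.
  by exists A => y; rewrite -[y in RHS]mul1r !BM BA mulmxA.
pose minor (J : {ffun 'I_r -> 'I_N}) x := \det (colsub J (B x)).
have minorP J : polyfun (minor J).
  apply: polyfun_det => i j; under eq_fun do rewrite !mxE -[_ * _]mulr1.
  exact: (polyfun_translate (t i) 1 (uP (J j))).
have minorZ J x : x \is a mxOver Num.int -> minor J x \is a Num.int.
  move=> xZ; apply: det_int; apply/mxOverP => i j; rewrite !mxE.
  apply: (mxOverP (uZ _ _)); apply: mxOverM => //.
  by have [] := PV _ (tP i).
have minor_mul x y J : minor J (x * y) = \sum_(K : {ffun 'I_r -> 'I_N})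
    minor K x * \prod_j colsub J (rho y) (K j) j.
  by rewrite /minor BM -mulmx_colsub det_mulmx_minors.
have [C BC] := row_freeP free.
have [J0 J0P] : exists J, minor J 1 != 0.
  have [J J1|J0] := pickP (fun J => minor J 1 != 0); first by exists J.
  have := det1 R r; rewrite -BC det_mulmx_minors big1 => [/eqP|K _].
    by rewrite eq_sym oner_eq0.
  by have /negbFE/eqP := J0 K; rewrite /minor => ->; rewrite mul0r.
have minor_sign x : P x -> exists2 e : R, e ^+ 2 = 1 &
    forall J, minor J x = e * minor J 1.
  have scale z : P z -> exists2 e : R, 1 <= `|e| &
      forall J y, minor J (z * y) = e * minor J y.
    move=> Pz; have [A BA] := BP z Pz.
    have minorA J y : minor J (z * y) = \det A * minor J y.
      by rewrite /minor BA -mulmx_colsub det_mulmx.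
    exists (\det A) => //; have [uz _ _] := PV _ Pz.
    apply: (norm_ge1_of_integral_orbit _ J0P) => [|m].
      by apply: contra_neq J0P => A0; rewrite -(mulrV uz) minorA A0 mul0r.
    have -> : \det A ^+ m * minor J0 1 = minor J0 (z ^+ m).
      elim: m => [|m IHm]; first by rewrite expr0 mul1r.
      by rewrite exprS -mulrA IHm -minorA -exprS.
    apply: minorZ; suff /PV[] : P (z ^+ m) by [].
    by elim: m => [|m Pm]; rewrite ?expr0 // exprS; exact: PM.
  move=> Px; have [ux _ Pxv] := PV _ Px.
  have [e e1 eM] := scale _ Px; have [e' e'1 e'M] := scale _ Pxv.
  exists e => [|J]; last by rewrite -eM mulr1.
  have : e * e' * minor J0 1 = minor J0 1.
    by rewrite -mulrA -e'M -eM mulr1 mulrV.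
  move=> /(canRL (mulfK J0P)); rewrite mulfV // => /(congr1 Num.norm).
  rewrite normrM normr1 => ee'; rewrite -[e ^+ 2]ger0_norm ?sqr_ge0 // normrX.
  have -> : `|e| = 1 by apply/eqP; rewrite eq_le e1 -ee' ler_peMr.
  exact: expr1n.
pose f (JK : {ffun 'I_r -> 'I_N} * {ffun 'I_r -> 'I_N}) x :=
  minor JK.1 x * minor JK.2 x.
exists ({ffun 'I_r -> 'I_N} * {ffun 'I_r -> 'I_N})%type, f; split.
- by move=> i; exact: polyfunM.
- by move=> i g gZ; rewrite rpredM ?minorZ.
- move=> g h fgh x i; rewrite /f !minor_mul !big_distrlr /=.
  apply: eq_bigr => K _; apply: eq_bigr => L _.
  by rewrite mulrACA [RHS]mulrACA; congr (_ * _); exact: (fgh (K, L)).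
- by move=> x i /minor_sign[e e1 ex]; rewrite /f !ex mulrACA -expr2 e1 mul1r.
- move=> fg0.
  have det_sq D : \det (B g0 *m D) ^+ 2 = \det (B 1 *m D) ^+ 2.
    rewrite !det_mulmx_minors !expr2 !big_distrlr /=.
    apply: eq_bigr => K _; apply: eq_bigr => L _.
    by rewrite mulrACA [RHS]mulrACA; congr (_ * _); exact: (fg0 (K, L)).
  have B1c : B 1 *m c = 0.
    apply/colP => j; rewrite [RHS]mxE -(qP _ (tP j)) uE.
    have -> : u (t j) = row j (B 1) by rewrite rowK mulr1.
    by rewrite -row_mul !mxE.
  (* As [u 1] is in the span of the rows of [B 1], [q g0] is a combination of
     the entries of [B g0 *m c]. *)
  have v0 : B g0 *m c != 0.
    apply: contra_neq qg0 => Bc0; have /submxP[w uw] := span _ P1.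
    by rewrite uE -[g0]mul1r uM uw -(mulmxA w) -BM mul1r -mulmxA Bc0 mulmx0 mxE.
  have [j vj] : exists j, (B g0 *m c) j 0 != 0.
    have /matrix0Pn[i [k]] := v0; rewrite (ord1 k) => vi.
    by exists i.
  pose e : 'rV[R]_r := ((B g0 *m c) j 0)^-1 *: delta_mx 0 j.
  have ev : e *m (B g0 *m c) = 1%:M.
    apply/rowP => k; rewrite ord1 -scalemxAl -rowE !mxE.
    by rewrite mulVf //; move: vj; rewrite mxE.
  (* [C - c (e B(g0) C)] is a right inverse of [B 1], because [B 1 c = 0], but
     its product with [B g0] factors through [1 - B(g0) c e], which kills the
     nonzero vector [B(g0) c]. *)
  have := det_sq (C - c *m (e *m B g0 *m C)).
  rewrite !mulmxBr !(mulmxA (B _) c) B1c mul0mx subr0 BC det1 expr1n.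
  have -> : B g0 *m C - B g0 *m c *m (e *m B g0 *m C) =
      (1%:M - B g0 *m c *m e) *m (B g0 *m C).
    by rewrite mulmxBl mul1mx !mulmxA.
  rewrite det_mulmx (_ : \det (1%:M - _) = 0) ?mul0r ?expr0n => [/eqP|].
    by rewrite eq_sym oner_eq0.
  apply/eqP/negPn/negP => D0; move: v0.
  have D_unit : 1%:M - B g0 *m c *m e \in unitmx by rewrite unitmxE unitfE.
  rewrite -(mulKmx D_unit (B g0 *m c)) mulmxBl mul1mx.
  rewrite -(mulmxA (B g0 *m c) e) ev mulmx1.
  by rewrite subrr mulmx0 eqxx.
Qed.

End SeparatingInvariants.

(** * The topology of the group of real points *)

Section RealPointsTopology.
Variables (R : realType) (n : nat) (G : Qgroup R n).
Local Open Scope ring_scope.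
Implicit Types x y b c : rpoints G.

#[global] Instance rpoints_nbhs_filter x : ProperFilter (nbhs x) :=
  nbhs_pfilter x.

Lemma mx_of_unit x : mx_of x \is a GRing.unit.
Proof. by case: (mx_ofP x). Qed.

Lemma continuous_mx_of : continuous (@mx_of R n G).
Proof. exact: (@initial_continuous _ _ (@mx_of R n G)). Qed.

Lemma continuous_polyfun q : polyfun q -> continuous (fun x => q (mx_of x)).
Proof.
elim=> {q} [c|i j|p q _ IHp _ IHq|p q _ IHp _ IHq] x.
- exact: cst_continuous.
- exact: (cvg_comp (@mx_of R n G) _ (@continuous_mx_of x) (@coord_continuous _ _ _ i j _)).
- exact: continuousD (IHp x) (IHq x).
- exact: continuousM (IHp x) (IHq x).
Qed.

Lemma continuous_to_rpoints (T : topologicalType) (f : T -> rpoints G) :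
  (forall i j, continuous (fun t => mx_of (f t) i j : R)) -> continuous f.
Proof.
move=> fc; apply: (@continuous_comp_initial _ _ _ (@mx_of R n G)).
move=> t A [P Pt PA].
have : \forall s \near t, forall ij : 'I_n.+1 * 'I_n.+1,
    P ij.1 ij.2 (mx_of (f s) ij.1 ij.2).
  by apply: filter_forall => -[i j] /=; exact: fc (Pt i j).
by apply: filterS => s fs; apply: PA => i j; exact: (fs (i, j)).
Qed.

Lemma continuous_mulg2 b c : continuous (fun x => b * x * c)%g.
Proof.
apply: continuous_to_rpoints => i j.
have := polyfun_translate (mx_of b) (mx_of c) (polyfun_entry R i j).
exact: continuous_polyfun.
Qed.

Lemma continuous_invg : continuous (fun x => x^-1)%g.
Proof.
apply: continuous_to_rpoints => i j x.
have E y : mx_of (y^-1)%g i j = (\det (mx_of y))^-1 * cofactor (mx_of y) j i.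
  have uy : mx_of y \in unitmx := mx_of_unit y.
  have -> : mx_of (y^-1)%g = invmx (mx_of y) by [].
  by rewrite /invmx uy !mxE.
rewrite (funext E).
have cofP : polyfun (fun g : 'M[R]_n.+1 => cofactor g j i).
  apply: polyfunM; first exact: polyfun_cst.
  apply: polyfun_det => k l; under eq_fun do rewrite !mxE.
  exact: polyfun_entry.
have detP : polyfun (fun g : 'M[R]_n.+1 => \det g).
  by apply: polyfun_det => k l; exact: polyfun_entry.
apply: continuousM (@continuous_polyfun _ cofP x).
apply: continuousV (@continuous_polyfun _ detP x).
by have := mx_of_unit x; rewrite -[_ \is a _]/(mx_of x \in unitmx) unitmxE unitfE.
Qed.

(** These balls form a countable base of the topology of [rpoints G]. *)
Definition rational_ball (B : 'M[rat]_n.+1 * nat) : set (rpoints G) :=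
  [set x | forall i j, `|mx_of x i j - ratr (B.1 i j)| < B.2.+1%:R^-1].

Lemma open_rational_ball B : open (rational_ball B).
Proof.
rewrite openE => x Bx.
have : \forall y \near x, forall ij : 'I_n.+1 * 'I_n.+1,
    `|mx_of y ij.1 ij.2 - ratr (B.1 ij.1 ij.2)| < B.2.+1%:R^-1.
  apply: (@filter_forall _ _ _ _ (nbhs_filter x)) => -[i j] /=.
  have : (fun y => mx_of y i j - ratr (B.1 i j)) @ x -->
      mx_of x i j - ratr (B.1 i j).
    apply: cvgB; last exact: cvg_cst.
    exact: (@continuous_polyfun _ (polyfun_entry R i j) x).
  by move=> /cvg_norm /cvgr_lt; apply; exact: Bx.
by apply: filterS => y By i j; exact: (By (i, j)).
Qed.

Lemma rational_ball_base x (A : set (rpoints G)) : nbhs x A ->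
  exists B, rational_ball B x /\ rational_ball B `<=` A.
Proof.
move=> [_ [[U Uo <-] Ux UA]].
have /nbhs_ballP[e e0 eB] : nbhs (mx_of x) U by exact: open_nbhs_nbhs.
have [m me] : exists m, m.+1%:R^-1 < e / 2.
  have e2 : 0 < e / 2 by rewrite divr_gt0.
  have [m _ mP] := near_infty_natSinv_lt (PosNum e2).
  by exists m; exact: (mP m (leqnn m)).
have m0 : 0 < m.+1%:R^-1 :> R by rewrite invr_gt0.
have q_ex (ij : 'I_n.+1 * 'I_n.+1) :
    exists q : rat, `|mx_of x ij.1 ij.2 - ratr q| < m.+1%:R^-1.
  have [|q] := @rat_in_itvoo R (mx_of x ij.1 ij.2)
    (mx_of x ij.1 ij.2 + m.+1%:R^-1).
    by rewrite ltrDl.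
  rewrite in_itv /= => /andP[q1 q2]; exists q.
  rewrite ltr_norml; move: (m.+1%:R^-1) m0 q2 => d d0 q2.
  by apply/andP; split; lra.
have [q qP] := choice q_ex.
exists (\matrix_(i, j) q (i, j), m); split.
  by move=> i j; rewrite mxE; exact: (qP (i, j)).
move=> y ym; apply: UA; apply: eB; split=> // i j.
have := ym i j; rewrite mxE /= => yq; have := qP (i, j) => /= xq.
rewrite /ball /= -[X in X - _](subrK (ratr (q (i, j)))) -addrA.
apply: le_lt_trans (ler_normD _ _) _; rewrite [X in _ + X]distrC.
by move: (m.+1%:R^-1) me xq yq => d; lra.
Qed.

End RealPointsTopology.

Section NearInteger.
Local Open Scope ring_scope.

(** At most one integer lies within [1/2] of [v]. *)
Lemma near_integer_eq (R : realType) (v : R) :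
  \forall t \near v, t \is a Num.int -> t = v.
Proof.
have [[t0 [t0Z t0v t0near]]|none] :=
  pselect (exists t0 : R, [/\ t0 \is a Num.int, t0 != v & `|t0 - v| < 2^-1]).
  exists `|t0 - v| => /= [|t]; first by rewrite normr_gt0 subr_eq0.
  rewrite /= distrC => tv tZ.
  suff Et : t = t0 by move: tv; rewrite Et ltxx.
  apply/eqP; rewrite -subr_eq0; apply/negPn/negP => nz.
  have := norm_intr_ge1 (rpredB tZ t0Z) nz; apply/negP; rewrite -ltNge.
  have -> : t - t0 = (t - v) - (t0 - v) by ring.
  apply: le_lt_trans (ler_normB _ _) _; lra.
exists 2^-1 => /= [|t]; first by rewrite invr_gt0.
rewrite /= distrC => tv tZ.
apply/eqP/negPn/negP => nz; apply: none; by exists t.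
Qed.

End NearInteger.

(** * Borel sets and local homeomorphisms *)

Section BorelMaps.
Variables (T1 T2 : ptopologicalType) (p : T1 -> T2).

Lemma borel_preimage (A : set (borel T2)) : continuous p ->
  measurable A -> measurable (p @^-1` A : set (borel T1)).
Proof.
move=> pc mA; rewrite -[_ @^-1` _]setTI.
suff : @measurable_fun _ _ (borel T1) (borel T2) setT p by apply.
apply: (@measurability _ _ (borel T1) (borel T2) setT p (@open T2)) => //.
move=> _ [B Bo <-].
by rewrite setTI; apply: sub_gen_smallest; move/continuousP : pc; apply.
Qed.

(** An open map that is injective on the pieces of a countable open cover sends
    Borel sets to Borel sets: on such a piece it commutes with complements. *)
Lemma borel_image (I : countType) (U : I -> set T1) (B : set (borel T1)) :
  (forall A, open A -> open (p @` A)) -> (forall i, open (U i)) ->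
  (forall x, exists i, U i x /\ {in U i &, injective p}) ->
  measurable B -> measurable (p @` B : set (borel T2)).
Proof.
move=> popen Uo Ucov mB.
pose J := [set i | {in U i &, injective p}].
have -> : p @` B = \bigcup_(i in J) p @` (B `&` U i).
  apply/seteqP; split=> [_ [x Bx <-]|_ [i _ [x [Bx _] <-]]]; last by exists x.
  by have [i [Uix pi]] := Ucov x; exists i => //; exists x.
rewrite bigcup_mkcond; apply: countable_bigcupT_measurable => [|i].
  exact: countableP.
case: ifPn => // /set_mem pinj.
move: B mB; apply: smallest_sub; last first.
  by move=> A Ao; apply: sub_gen_smallest; apply: popen; exact: openI.
split=> [|A mA|A mA] /=.
- by rewrite set0I image_set0.
- have -> : p @` ((setT `\` A) `&` U i) = p @` (U i) `\` p @` (A `&` U i).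
    apply/seteqP; split=> [_ [x [[_ nAx] Ux] <-]|_ [[x Ux <-] nA]].
      split=> [|[y [Ay Uy] /pinj]]; first by exists x.
      by rewrite !inE => /(_ Uy Ux) yx; apply: nAx; rewrite -yx.
    by exists x => //; split=> //; split=> // Ax; apply: nA; exists x.
  by apply: measurableD => //; apply: sub_gen_smallest; exact: popen.
- by rewrite setI_bigcupl image_bigcup; apply: bigcupT_measurable.
Qed.

End BorelMaps.

(** * The quotient by the integer points *)

Section Homspace.
Variables (R : realType) (n : nat) (G : Qgroup R n).
Local Open Scope ring_scope.
Implicit Types x y b c : rpoints G.

Lemma open_homspace (A : set (homspace G)) : open A <-> open (@coset_pi R n G @^-1` A).
Proof. by []. Qed.

Lemma continuous_translate b : continuous (@translate R n G b).
Proof.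
apply/continuousP => A /open_homspace Ao; apply/open_homspace.
have -> : @coset_pi R n G @^-1` (@translate R n G b @^-1` A) =
    (fun x => b * x * 1)%g @^-1` (@coset_pi R n G @^-1` A).
  by apply/funext => x /=; rewrite translate_pi mulg1.
by have /continuousP := @continuous_mulg2 R n G b 1%g; apply.
Qed.

Lemma coset_pi_open (A : set (rpoints G)) : open A -> open (@coset_pi R n G @` A).
Proof.
move=> Ao; apply/open_homspace.
have -> : @coset_pi R n G @^-1` (@coset_pi R n G @` A) =
    \bigcup_(c in zpoints (G := G)) ((fun x => 1 * x * c)%g @^-1` A).
  apply/seteqP; split=> [x [y Ay /esym/coset_piP]|x [c Zc]] /=.
    by exists (x^-1 * y)%g => //=; rewrite mul1g mulVKg.
  rewrite mul1g => Axc; exists (x * c)%g => //; apply/esym/coset_piP.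
  by rewrite mulKg.
apply: bigcup_open => c _.
by have /continuousP := @continuous_mulg2 R n G 1%g c; apply.
Qed.

Lemma zpoints_near1 b : zpoints b ->
  (forall i j, `|mx_of b i j - (i == j)%:R| < 1) -> b = 1%g.
Proof.
move=> [/mxOverP bZ _] b1; apply: mx_of_inj; apply/matrixP => i j.
have -> : mx_of (1%g : rpoints G) = 1%:M by [].
rewrite mxE; apply/eqP; rewrite -subr_eq0; apply: contraLR (b1 i j) => nz.
by rewrite -leNgt norm_intr_ge1 // rpredB // intr_nat.
Qed.

(** If [y] and [z] are near [x] and in the same coset, then [y^-1 z] is an
    integral matrix near [1]. *)
Lemma coset_pi_locally_injective x :
  exists2 A, nbhs x A & {in A &, injective (@coset_pi R n G)}.
Proof.
pose F := filter_prod (nbhs x) (nbhs x).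
have FF : Filter F by exact: filter_prod_filter.
have entryc i j : continuous (fun y => mx_of y i j : R).
  exact: (continuous_polyfun (polyfun_entry R i j)).
have near1 : F (fun p => forall ij : 'I_n.+1 * 'I_n.+1,
    `|mx_of (p.1^-1 * p.2)%g ij.1 ij.2 - (ij.1 == ij.2)%:R| < 1).
  apply: (@filter_forall _ _ _ F FF) => -[i j] /=.
  suff : (fun p => mx_of (p.1^-1 * p.2)%g i j - (i == j)%:R) @ F --> (0 : R).
    by move=> /cvgr0_norm_lt; apply.
  have <- : mx_of (x^-1 * x)%g i j - (i == j)%:R = 0.
    have -> : mx_of (x^-1 * x)%g = 1%:M by rewrite mulVg.
    by rewrite mxE subrr.
  apply: cvgB; last exact: cvg_cst.
  have E (p : rpoints G * rpoints G) : mx_of (p.1^-1 * p.2)%g i j =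
      \sum_k mx_of (p.1^-1)%g i k * mx_of p.2 k j.
    by rewrite -[LHS]/((mx_of (p.1^-1)%g *m mx_of p.2) i j) mxE.
  rewrite (funext E) (E (x, x)) /=.
  apply: cvg_big => [|k _]; first exact: add_continuous.
  apply: cvgM.
    apply: (cvg_comp (fun p : rpoints G * rpoints G => p.1^-1)%g
      (fun y => mx_of y i k)); last exact: entryc.
    apply: (cvg_comp fst (fun y : rpoints G => y^-1)%g cvg_fst).
    exact: continuous_invg.
  by apply: (cvg_comp snd (fun y => mx_of y k j) cvg_snd); exact: entryc.
have [[A B] /= [Ax Bx] AB] := near1.
exists (A `&` B); first exact: filterI.
move=> y z; rewrite !inE => -[Ay By] [Az Bz] /coset_piP Zyz.
have := zpoints_near1 Zyz (fun i j => AB (y, z) (conj Ay Bz) (i, j)).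
by move=> /(canRL (mulVKg y)); rewrite mulg1.
Qed.

Lemma measurable_coset_pi (B : set (borel (rpoints G))) :
  measurable B -> measurable (@coset_pi R n G @` B : set (borel (homspace G))).
Proof.
apply: (@borel_image _ _ _ _ (@rational_ball R n G)).
- exact: coset_pi_open.
- exact: open_rational_ball.
- move=> x; have [A Ax Ainj] := coset_pi_locally_injective x.
  have [b [bx bA]] := rational_ball_base Ax; exists b; split=> //.
  by move=> y z /set_mem/bA/mem_set yA /set_mem/bA/mem_set zA; exact: Ainj.
Qed.

End Homspace.

(** * Poincare recurrence *)

Section Poincare.
Context {d : measure_display} {T : measurableType d} {R : realType}.
Variables (mu : probability T R) (f : T -> T).
Hypothesis f_inv :
  forall A, measurable A -> measurable (f @^-1` A) /\ mu (f @^-1` A) = mu A.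
Local Open Scope ring_scope.

Lemma iter_preserves k A : measurable A ->
  measurable (iter k f @^-1` A) /\ mu (iter k f @^-1` A) = mu A.
Proof.
move=> mA; elim: k => [|k [mk muk]] //.
have -> : iter k.+1 f @^-1` A = f @^-1` (iter k f @^-1` A).
  by apply/funext => z; rewrite /preimage /= -iterS iterSr.
by have [? ->] := f_inv mk.
Qed.

(** Let [W] be the set of points of [Z] that do not return after time [m].  The
    preimages of [W] under the multiples of [m] are disjoint and have the same
    measure, so that measure is [0]. *)
Lemma poincare_recurrence (Z : set T) (m : nat) : (0 < m)%N -> measurable Z ->
  mu.-negligible [set z | Z z /\ forall k, (m <= k)%N -> ~ Z (iter k f z)].
Proof.
move=> m0 mZ; set W := [set z | _].
have mW : measurable W.
  have -> : W = Z `&` \bigcap_(k in [set k | (m <= k)%N]) (~` (iter k f @^-1` Z)).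
    by apply/seteqP; split=> z [Zz Hz]; split.
  apply: measurableI => //; apply: bigcap_measurable => [|k _].
    by exists m => /=.
  by apply: measurableC; have [] := iter_preserves k mZ.
apply/negligibleP => //.
pose D j := iter (j * m) f @^-1` W.
have mD j : measurable (D j) by have [] := iter_preserves (j * m) mW.
have disjoint_lt i j : (i < j)%N -> D i `&` D j = set0.
  move=> ij; rewrite -subset0 => z [[_ Di] [Dj _]].
  apply: (Di (j * m - i * m)%N).
    by rewrite -mulnBl -[leqLHS]mul1n leq_mul2r subn_gt0 ij orbT.
  by rewrite -iterD subnK // leq_mul2r ltnW ?orbT.
have tD : trivIset setT D.
  apply/trivIsetP => i j _ _; rewrite neq_ltn => /orP[/disjoint_lt //|].
  by rewrite setIC => /disjoint_lt.
have muW : mu W = (fine (mu W))%:E by rewrite fineK // fin_num_measure.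
have bound N : N%:R * fine (mu W) <= 1.
  rewrite -lee_fin.
  have -> : (N%:R * fine (mu W))%:E = mu (\big[setU/set0]_(i < N) D i).
    rewrite measure_bigsetU //.
    rewrite (eq_bigr (fun=> (fine (mu W))%:E)) => [|i _].
      by rewrite sumEFin sumr_const card_ord mulr_natl.
    by rewrite -muW; have [] := iter_preserves (i * m) mW.
  by apply: probability_le1; exact: bigsetU_measurable.
rewrite -[LHS]/(mu W) muW; congr EFin; apply/eqP; rewrite eq_le fine_ge0 // andbT leNgt.
apply/negP => w0; have := archi_boundP (ltW (_ : 0 < (fine (mu W))^-1)).
rewrite invr_gt0 => /(_ w0); rewrite -[X in X < _]mul1r ltr_pdivrMr //.
by rewrite ltNge bound.
Qed.

End Poincare.

(** * Integer powers and translations of the quotient *)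

Section IntegerPowers.
Local Open Scope ring_scope.
Variables (gT : groupType) (a : gT).

Lemma zpowSr k : zpow a (k + 1) = (zpow a k * a)%g.
Proof.
case: k => [k|[|k]] /=.
- by rewrite addn1 expgSr.
- by rewrite expg1 mulVg.
- by rewrite subn1 /= [in RHS]expgS invgM mulgVK.
Qed.

Lemma zpowD k l : zpow a (k + l) = (zpow a k * zpow a l)%g.
Proof.
have nat_case j (m : nat) : zpow a (j + Posz m) = (zpow a j * a ^+ m)%g.
  elim: m => [|m IHm]; first by rewrite addr0 mulg1.
  by rewrite -addn1 PoszD addrA zpowSr IHm addn1 expgSr mulgA.
case: l => [m|m]; first exact: nat_case.
apply: (mulIg (a ^+ m.+1)%g); rewrite /= -mulgA mulVg mulg1 -nat_case NegzE.
by rewrite subrK.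
Qed.

Lemma zpowN k : zpow a (- k) = (zpow a k)^-1%g.
Proof. by apply: (mulIg (zpow a k)); rewrite -zpowD addNr mulVg. Qed.

End IntegerPowers.

Section Translations.
Variables (R : realType) (n : nat) (G : Qgroup R n).
Implicit Types b c : rpoints G.

Lemma translateM b c z : translate b (translate c z) = translate (b * c)%g z.
Proof.
by rewrite -(coset_reprK z) !translate_pi mulgA.
Qed.

Lemma translate1 (z : homspace G) : translate 1%g z = z.
Proof. by rewrite -(coset_reprK z) translate_pi mul1g. Qed.

Lemma iter_translate b k z : iter k (translate b) z = translate (b ^+ k)%g z.
Proof.
elim: k => [|k IHk]; first by rewrite translate1.
by rewrite iterS IHk translateM expgS.
Qed.

Lemma measurable_translate b (A : set (borel (homspace G))) :
  measurable A -> measurable (translate b @^-1` A : set (borel (homspace G))).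
Proof. by apply: borel_preimage; exact: continuous_translate. Qed.

Lemma zpow_invariant (a : rpoints G) (mu : probability (borel (homspace G)) R) k :
  invariant_measure a mu -> invariant_measure (zpow a k) mu.
Proof.
move=> inv.
have comp b c (A : set (homspace G)) :
    translate (b * c)%g @^-1` A = translate c @^-1` (translate b @^-1` A).
  by apply/funext => z; rewrite /preimage /= translateM.
have pow (m : nat) : invariant_measure (a ^+ m)%g mu.
  elim: m => [|m IHm] A mA.
    by congr (mu _); apply/funext => z; rewrite /preimage /= translate1.
  by rewrite expgS comp IHm ?inv //; exact: measurable_translate.
case: k => m A mA /=; first exact: pow.
rewrite -(pow m.+1); last exact: measurable_translate.
by rewrite -comp mulVg; congr (mu _); apply/funext => z;
  rewrite /preimage /= translate1.
Qed.

End Translations.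

(** * Return times and the essentially constant orbit map *)

Section ReturnTimes.
Variables (R : realType) (n : nat) (G : Qgroup R n).
Variables (a : rpoints G) (mu : probability (borel (homspace G)) R).
Hypotheses (mu_inv : invariant_measure a mu) (mu_erg : ergodic_measure a mu).
Variables (I E : set (rpoints G)).
Hypotheses (EI : E `<=` I) (E_meas : measurable (E : set (borel (rpoints G)))).
Variable H : set (rpoints G).
Hypotheses (HG : is_subgroup H) (HP : return_elements a mu I E `<=` H).
(* [F] is the restriction to the real points of a family as in
   [separating_invariants], for the group [H `&` zpoints]. *)
Variables (J : finType) (F : J -> rpoints G -> R).
Hypotheses (F_cont : forall i, continuous (F i))
  (F_int : forall i c, zpoints c -> F i c \is a Num.int)
  (F_mul : forall g h, (forall i, F i g = F i h) ->
     forall x i, F i (g * x)%g = F i (h * x)%g)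
  (F_H : forall i c, H c -> zpoints c -> F i c = F i 1%g)
  (F_posrec : forall i x, posrec (fun k => F i (x * a ^+ k)%g)).
Local Open Scope ring_scope.
Implicit Types (x y c : rpoints G) (B : set (rpoints G)).

Let pi := @coset_pi R n G.

(** On subsets of a fundamental domain, this is negligibility for the lift of
    [mu]. *)
Let null B := mu.-negligible (pi @` B).

Let null_sub B1 B2 : B1 `<=` B2 -> null B2 -> null B1.
Proof. by move=> s; apply: negligibleS => _ [x Bx <-]; exists x => //; exact: s. Qed.

Let null_bigcup (K : countType) (B : K -> set (rpoints G)) :
  (forall k, null (B k)) -> null (\bigcup_k B k).
Proof.
move=> nB; rewrite /null image_bigcup.
pose D (m : nat) : set (borel (homspace G)) :=
  oapp (fun k => pi @` B k) set0 (unpickle m).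
apply: (@negligibleS _ _ _ mu (\bigcup_m D m)).
  by move=> z [k _ Bz]; exists (pickle k) => //; rewrite /D pickleK.
rewrite /D; apply: negligible_bigcup => m; case: unpickle => [k|] /=; first exact: nB.
exact: negligible_set0.
Qed.

Let nullU B1 B2 : null B1 -> null B2 -> null (B1 `|` B2).
Proof. by move=> n1 n2; rewrite /null image_setU; exact: negligibleU. Qed.

Let measurable_pi B : measurable (B : set (borel (rpoints G))) ->
  measurable (pi @` B : set (borel (homspace G))).
Proof. exact: measurable_coset_pi. Qed.

Lemma F_mulg2_cont i b c : continuous (fun y => F i (b * y * c)%g).
Proof.
move=> y; apply: (cvg_comp (fun y => b * y * c)%g (F i)).
  exact: continuous_mulg2.
exact: F_cont.
Qed.

Lemma F_inv_cont i c : continuous (fun y => F i (y^-1 * c)%g).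
Proof.
have -> : (fun y => F i (y^-1 * c)%g) = (fun y => F i (1 * y^-1 * c)%g).
  by apply/funext => y; rewrite mul1g.
move=> x; apply: (cvg_comp (fun y : rpoints G => y^-1)%g
  (fun z : rpoints G => F i (1 * z * c)%g)); first exact: continuous_invg.
exact: F_mulg2_cont.
Qed.

(** The point [x] returns to [E] only through elements of [H], and it comes
    back to [E], close to itself, at arbitrarily large negative times. *)
Definition good_point x :=
  (forall k c, zpoints c -> E (zpow a k * x * c)%g -> H c) /\
  (forall b m, rational_ball b x -> exists k c,
     [/\ (m <= k)%N, zpoints c & (E `&` rational_ball b) (a ^- k * x * c)%g]).

Lemma null_not_return c : zpoints c -> ~ H c ->
  null (\bigcup_(k : int) ([set (zpow a k * x * c)%g | x in E] `&` E)).
Proof.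
move=> Zc nHc; set N := \bigcup_k _.
have NE : N `<=` E by move=> x [k _ []].
have mN : measurable (N : set (borel (rpoints G))).
  apply: countable_bigcupT_measurable => [|k]; first exact: countableP.
  apply: measurableI => //.
  have -> : [set (zpow a k * x * c)%g | x in E] =
      (fun x => (zpow a k)^-1 * x * c^-1)%g @^-1` E.
    apply/seteqP; split=> [_ [x Ex <-]|x Ex] /=.
      by rewrite mulgA mulgK mulKg.
    by exists ((zpow a k)^-1 * x * c^-1)%g => //; rewrite !mulgA mulgV mul1g mulgVK.
  by apply: borel_preimage => //; exact: continuous_mulg2.
apply/negligibleP; first exact: measurable_pi.
apply/eqP; rewrite eq_le measure_ge0 andbT leNgt; apply/negP => N_pos.
apply: nHc; apply: HP; split=> //; rewrite /lifted_measure setIidl //.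
exact: subset_trans EI.
Qed.

Lemma null_not_recurrent b m :
  null [set x | (E `&` rational_ball b) x /\ forall k c, (m <= k)%N ->
    zpoints c -> ~ (E `&` rational_ball b) (a ^- k * x * c)%g].
Proof.
have mEb : measurable (E `&` rational_ball b : set (borel (rpoints G))).
  by apply: measurableI => //; apply: sub_gen_smallest; exact: open_rational_ball.
have inv (A : set (borel (homspace G))) : measurable A ->
    measurable (translate a^-1%g @^-1` A : set (borel (homspace G))) /\
    mu (translate a^-1%g @^-1` A) = mu A.
  move=> mA; split; first exact: measurable_translate.
  by have := zpow_invariant (Negz 0) mu_inv; rewrite /= expg1; apply.
apply: negligibleS (@poincare_recurrence _ (borel (homspace G)) R
  mu (translate a^-1%g) inv _ m.+1 (ltn0Sn m) (measurable_pi mEb)).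
move=> _ [x [Ebx nEb] <-]; split=> [|k mk [y Eby]]; first by exists x.
rewrite iter_translate translate_pi expVgn => /esym/coset_piP Zc.
apply: (nEb k _ (ltnW mk) Zc).
by rewrite mulVKg.
Qed.

(** A point that returns to [E] through [c] outside [H] belongs to the negligible
    set of [null_not_return] for [c^-1], and there are countably many [c]. *)
Lemma null_bad : null [set x | E x /\ ~ good_point x].
Proof.
have [_ _ HV] := HG; have [_ _ ZV] := @zpoints_subgroup R n G.
pose zmat c : 'M[int]_n.+1 := map_mx Num.floor (mx_of c).
have zmat_inj c c' : zpoints c -> zpoints c' -> zmat c = zmat c' -> c = c'.
  move=> [/mxOverP cZ _] [/mxOverP c'Z _] /matrixP Ecc.
  apply: mx_of_inj; apply/matrixP => i j.
  by have := Ecc i j; rewrite !mxE => Eij; rewrite -(floorK (cZ i j)) Eij floorK.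
pose N c := \bigcup_(k : int) ([set (zpow a k * x * c)%g | x in E] `&` E).
pose B1 (M : 'M[int]_n.+1) :=
  [set x | exists c, [/\ zpoints c, ~ H c, zmat c = M & N c x]].
pose B2 (bm : ('M[rat]_n.+1 * nat) * nat) :=
  [set x | (E `&` rational_ball bm.1) x /\ forall k c, (bm.2 <= k)%N ->
    zpoints c -> ~ (E `&` rational_ball bm.1) (a ^- k * x * c)%g].
apply: (@null_sub _ ((\bigcup_M B1 M) `|` (\bigcup_bm B2 bm))).
  move=> x [Ex /not_andP[]].
    move=> /existsNP[k /existsNP[c /not_implyP[Zc /not_implyP[Ey nHc]]]].
    left; exists (zmat c^-1%g) => //; exists (c^-1)%g; split=> //.
    - exact: ZV.
    - by move=> /HV; rewrite invgK.
    - exists (- k) => //; split=> //; exists (zpow a k * x * c)%g => //.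
      by rewrite zpowN !mulgA mulVg mul1g mulgK.
  move=> /existsNP[b /existsNP[m /not_implyP[bx nrec]]].
  right; exists (b, m) => //; split=> // k c mk Zc Ec.
  by apply: nrec; exists k, c; split.
apply: nullU; last by apply: null_bigcup => -[b m]; exact: null_not_recurrent.
apply: null_bigcup => M.
have [[c [Zc nHc cM]]|none] :=
    pselect (exists c, [/\ zpoints c, ~ H c & zmat c = M]).
  apply: null_sub (null_not_return Zc nHc) => x [c' [Zc' _ c'M Nx]].
  by rewrite (zmat_inj c c') // cM c'M.
apply: (@null_sub _ set0); last by rewrite /null image_set0; exact: negligible_set0.
by move=> x [c [Zc nHc cM _]]; apply: none; exists c.
Qed.

Lemma F_left_invariant i c x : H c -> zpoints c -> F i (c * x)%g = F i x.
Proof.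
move=> Hc Zc; rewrite -[in RHS](mul1g x); apply: F_mul => j; exact: F_H.
Qed.

(** If [y = a ^- k * x * c] is close to [x], then [F i (y^-1 * a ^+ m)], which
    equals [F i (x^-1 * a ^+ (k + m))] by invariance under [c], is close to
    [F i (x^-1 * a ^+ m)].  So the sequence [F i (x^-1 * a ^+ m)] is recurrent. *)
Lemma good_point_fixed x : E x -> good_point x ->
  forall k i, F i (x^-1 * zpow a k)%g = F i x^-1%g.
Proof.
have [_ _ HV] := HG; have [_ _ ZV] := @zpoints_subgroup R n G.
move=> Ex [retH rec].
have pos (m : nat) i : F i (x^-1 * a ^+ m)%g = F i x^-1%g.
  have /posrec_recurrent E0 := F_posrec i x^-1%g.
  rewrite (E0 _ m 0%N) ?mulg1 // => {}m N e e0.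
  have /cvgr_dist_lt/(_ _ e0)/rational_ball_base[b [bx bA]] :=
    @F_inv_cont i (a ^+ m)%g x.
  have [k [c [Nk Zc [Ey yb]]]] := rec b N bx.
  exists k => //; have /= := bA _ yb; rewrite distrC.
  have Hc : H c by apply: (retH (- k%:Z) c) => //; rewrite zpowN.
  have -> : ((a ^- k * x * c)^-1 * a ^+ m = c^-1 * (x^-1 * a ^+ (k + m)))%g.
    by rewrite !invgM invgK expgnDr !mulgA.
  by rewrite F_left_invariant //; [exact: HV|exact: ZV].
move=> [m|m] i; first exact: pos.
have /F_mul /(_ (zpow a (Negz m)) i) := pos m.+1.
by rewrite /= mulgK.
Qed.

(** The smallest invariant set that contains the image of [B]. *)
Let sat B : set (homspace G) := [set z | exists k, (pi @` B) (translate (zpow a k) z)].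

Let sat_full B : measurable (B : set (borel (rpoints G))) ->
  ~ null B -> mu (sat B) = 1%E /\ measurable (sat B : set (borel (homspace G))).
Proof.
move=> mB nB.
have satE : sat B = \bigcup_(k : int) translate (zpow a k) @^-1` (pi @` B).
  by apply/seteqP; split=> z [k]; exists k.
have mS : measurable (sat B : set (borel (homspace G))).
  rewrite satE; apply: countable_bigcupT_measurable => [|k].
    exact: countableP.
  by apply: measurable_translate; exact: measurable_pi.
have inv : translate a @^-1` sat B = sat B.
  apply/seteqP; split=> z [k].
    by rewrite /= translateM -zpowSr => Bz; exists (k + 1).
  rewrite -[k](subrK 1) zpowSr -translateM => Bz; exists (k - 1).
  exact: Bz.
split=> //; have [mu0|//] := mu_erg mS inv.
exfalso; apply: nB; apply: (@negligibleS _ _ _ mu (sat B)).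
  by move=> z Bz; exists 0; rewrite translate1.
by apply/negligibleP.
Qed.

Let null_sat B : null B -> mu.-negligible (sat B).
Proof.
move=> nB; pose D (m : nat) : set (borel (homspace G)) :=
  oapp (fun k : int => translate (zpow a k) @^-1` (pi @` B)) set0 (unpickle m).
apply: (@negligibleS _ _ _ mu (\bigcup_m D m)).
  by move=> z [k Bz]; exists (pickle k) => //; rewrite /D pickleK.
apply: negligible_bigcup => m; rewrite /D; case: unpickle => [k|] /=; last first.
  exact: negligible_set0.
have [A [mA muA BA]] := nB; exists (translate (zpow a k) @^-1` A); split.
- exact: measurable_translate.
- by rewrite (zpow_invariant k mu_inv).
- by move=> z; exact: BA.
Qed.

(** By ergodicity, almost every point of the quotient has iterates in the images
    of both sets. *)
Lemma non_null_linked B1 B2 : B1 `<=` E -> B2 `<=` E ->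
  measurable (B1 : set (borel (rpoints G))) ->
  measurable (B2 : set (borel (rpoints G))) ->
  ~ null B1 -> ~ null B2 ->
  exists x y, [/\ B1 x, B2 y & forall i, F i x^-1%g = F i y^-1%g].
Proof.
have [_ _ HV] := HG; have [_ _ ZV] := @zpoints_subgroup R n G.
move=> B1E B2E mB1 mB2 nB1 nB2.
have [sat1 ms1] := sat_full mB1 nB1; have [sat2 ms2] := sat_full mB2 nB2.
have [z [[z1 z2] nbad]] : exists z, (sat B1 `&` sat B2) z /\
    ~ sat [set x | E x /\ ~ good_point x] z.
  apply: contrapT => none; have : mu setT = 0%E; last first.
    by rewrite probability_setT => /eqP; rewrite onee_eq0.
  have null_compl S : measurable (S : set (borel (homspace G))) ->
      mu S = 1%E -> mu.-negligible (~` S).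
    move=> mS S1; apply/negligibleP; first exact: measurableC.
    by rewrite -[LHS]/(mu (~` S)) probability_setC // S1 subee.
  apply/negligibleP => //.
  apply: (@negligibleS _ _ _ mu ((~` sat B1 `|` ~` sat B2) `|`
    sat [set x | E x /\ ~ good_point x])).
    move=> z _; apply: contrapT => /not_orP[/not_orP[/contrapT z1 /contrapT z2] z3].
    by apply: none; exists z.
  apply: negligibleU; last exact/null_sat/null_bad.
  by apply: negligibleU; exact: null_compl.
have [k [x B1x xz]] := z1; have [l [y B2y yz]] := z2.
have gx : good_point x.
  apply: contrapT => nx; apply: nbad; exists k; exists x => //; split=> //.
  exact: B1E.
exists x, y; split=> // i.
have : pi (zpow a (l - k) * x)%g = pi y.
  rewrite yz -[LHS]translate_pi -[coset_pi x]/(pi x) xz translateM.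
  by rewrite -zpowD subrK.
move=> /coset_piP Zxy; have [c Zc yE] : exists2 c, zpoints c &
    y = (zpow a (l - k) * x * c)%g by eexists; [exact: Zxy|rewrite mulVKg].
have Hc : H c by apply: (gx.1 (l - k)) => //; rewrite -yE; exact: B2E.
rewrite yE !invgM -zpowN F_left_invariant; [|exact: HV|exact: ZV].
by rewrite good_point_fixed //; exact: B1E.
Qed.

(** For each rational [q], the sets where [F i (x^-1) < q] and where
    [q <= F i (x^-1)] cannot both be non-negligible, by [non_null_linked].
    Two points outside all the negligible ones have the same values. *)
Lemma F_essentially_constant : ~ null E ->
  exists x0, [/\ E x0, good_point x0 &
    null [set x | E x /\ ~ forall i, F i x^-1%g = F i x0^-1%g]].
Proof.
move=> nE.
pose below (iq : J * rat) := E `&` [set x | F iq.1 x^-1%g < ratr iq.2].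
pose above (iq : J * rat) := E `&` [set x | ratr iq.2 <= F iq.1 x^-1%g].
have o_below iq : open [set x | F iq.1 x^-1%g < ratr iq.2].
  have /continuousP/(_ _ (@open_lt R (ratr iq.2))) := @F_inv_cont iq.1 1%g.
  by congr open; apply/funext => x; rewrite /preimage /= mulg1.
have m_below iq : measurable (below iq : set (borel (rpoints G))).
  by apply: measurableI => //; apply: sub_gen_smallest; exact: o_below.
have m_above iq : measurable (above iq : set (borel (rpoints G))).
  have -> : above iq = E `\` below iq.
    apply/seteqP; split=> x [Ex /=].
      by rewrite leNgt => /negP nb; split=> // -[].
    by move=> nb; split=> //=; rewrite leNgt; apply/negP => b; apply: nb.
  exact: measurableD.
pose trim B := [set x | B x /\ null B].
have null_trim B : null (trim B).
  have [nB|nB] := pselect (null B); first by apply: null_sub nB => x [].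
  apply: (@null_sub _ set0); first by move=> x [].
  by rewrite /null image_set0; exact: negligible_set0.
pose bad := [set x | E x /\ ~ good_point x] `|`
  (\bigcup_iq trim (below iq)) `|` (\bigcup_iq trim (above iq)).
have nbad : null bad.
  apply: nullU; last by apply: null_bigcup => iq; exact: null_trim.
  apply: nullU; first exact: null_bad.
  by apply: null_bigcup => iq; exact: null_trim.
have separated x y iq : below iq x -> ~ bad x -> above iq y -> ~ bad y -> False.
  move=> bx nx ay ny.
  have n_below : ~ null (below iq).
    by move=> nb; apply: nx; left; right; exists iq.
  have n_above : ~ null (above iq).
    by move=> na; apply: ny; right; exists iq.
  have [||x1 [y1 [[_ /= x1q] [_ /= y1q] xy]]] :=
    @non_null_linked (below iq) (above iq) _ _ (m_below iq) (m_above iq) n_below n_above.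
  - by move=> ? [].
  - by move=> ? [].
  by move: x1q; rewrite xy ltNge y1q.
have [x0 [Ex0 nx0]] : exists x0, E x0 /\ ~ bad x0.
  apply: contrapT => none; apply: nE; apply: null_sub nbad => x Ex.
  by apply: contrapT => nx; apply: none; exists x.
exists x0; split=> //.
  by apply: contrapT => ngx; apply: nx0; left; left.
apply: null_sub nbad => x [Ex neq]; apply: contrapT => nx; apply: neq => i.
apply/eqP; rewrite eq_le !leNgt; apply/andP; split; apply/negP.
- move=> /rat_in_itvoo[q]; rewrite in_itv /= => /andP[q1 q2].
  apply: (@separated x0 x (i, q)) => //; split=> //=.
  exact: ltW.
- move=> /rat_in_itvoo[q]; rewrite in_itv /= => /andP[q1 q2].
  apply: (@separated x x0 (i, q)) => //; split=> //=.
  exact: ltW.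
Qed.

(** The elements [g] that fix the value [F _ (x0^-1)] of the orbit map, that is
    [F i ((g * x0)^-1) = F i (x0^-1)]; the form below avoids inverses of [g]. *)
Definition conj_stabilizer x0 : set (rpoints G) :=
  [set g | forall i, F i (x0^-1 * g * x0)%g = F i 1%g].

Lemma conj_stabilizer_subgroup x0 : is_subgroup (conj_stabilizer x0).
Proof.
split=> [i|x y Sx Sy i|x Sx i].
- by rewrite mulg1 mulVg.
- have -> : (x0^-1 * (x * y) * x0 = x0^-1 * x * x0 * (x0^-1 * y * x0))%g.
    by rewrite !mulgA mulgK.
  by rewrite (F_mul Sx) mul1g.
- have := F_mul Sx (x0^-1 * x^-1 * x0)%g i.
  have -> : (x0^-1 * x * x0 * (x0^-1 * x^-1 * x0) = 1)%g.
    by rewrite !mulgA !mulgK mulVg.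
  by rewrite mul1g.
Qed.

Lemma orbit_conj_stabilizerP x0 x :
  orbit_of (conj_stabilizer x0) x0 (pi x) <->
  exists2 c, zpoints c & forall i, F i (x0^-1 * x)%g = F i c.
Proof.
split=> [[h Sh /coset_piP]|[c Zc Fc]].
  set c := (_^-1 * x)%g => Zc; exists c => // i.
  have -> : (x0^-1 * x = x0^-1 * h * x0 * c)%g.
    by rewrite /c invgM !mulgA !mulgK.
  by rewrite (F_mul Sh) mul1g.
exists (x * c^-1 * x0^-1)%g => [i|].
  by rewrite mulgA !mulgVK mulgA (F_mul Fc) mulgV.
by rewrite mulgVK; apply/coset_piP; rewrite invgM invgK mulgVK.
Qed.

(** By [orbit_conj_stabilizerP], the orbit is the preimage of the set of values
    of [F] on the integer points, and every set of integer vectors is closed. *)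
Lemma closed_orbit_conj_stabilizer x0 :
  closed (orbit_of (conj_stabilizer x0) x0).
Proof.
rewrite -[orbit_of _ _]setCK; apply: open_closedC; apply/open_homspace.
rewrite openE => x /= nCx.
have : \forall y \near x, forall i,
    F i (x0^-1 * y)%g \is a Num.int -> F i (x0^-1 * y)%g = F i (x0^-1 * x)%g.
  apply: (@filter_forall _ _ _ _ (nbhs_filter x)) => i.
  have near_int : \forall y \near x, F i (x0^-1 * y * 1)%g \is a Num.int ->
      F i (x0^-1 * y * 1)%g = F i (x0^-1 * x * 1)%g.
    exact: (@F_mulg2_cont i x0^-1%g 1%g x _ (near_integer_eq _)).
  by apply: filterS near_int => y; rewrite /= !mulg1.
apply: filterS => y Fy /orbit_conj_stabilizerP[c Zc Fc]; apply: nCx.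
apply/orbit_conj_stabilizerP; exists c => // i.
by rewrite -Fy Fc //; exact: F_int.
Qed.

(** The orbit is invariant under [a] and contains almost all of [E], so its
    measure is [1] by ergodicity. *)
Lemma full_orbit : ~ null E -> exists x0, conj_stabilizer x0 a /\
  mu (orbit_of (conj_stabilizer x0) x0) = 1%E.
Proof.
move=> nE; have [x0 [Ex0 gx0 cst]] := F_essentially_constant nE.
have Sa : conj_stabilizer x0 a.
  move=> i; have := good_point_fixed Ex0 gx0 1; rewrite /= expg1 => Fa.
  by rewrite (F_mul Fa) mulVg.
have [_ SM SV] := conj_stabilizer_subgroup x0.
exists x0; split=> //; set C := orbit_of _ _.
have mC : measurable (C : set (borel (homspace G))).
  rewrite -[C]setCK; apply: measurableC; apply: sub_gen_smallest.
  exact/closed_openC/closed_orbit_conj_stabilizer.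
have inv : translate a @^-1` C = C.
  apply/seteqP; split=> z; rewrite -(coset_reprK z); set x := coset_repr z.
    rewrite /= translate_pi => -[h Sh /coset_piP Zhx].
    exists (a^-1 * h)%g; first by apply: SM => //; exact: SV.
    by apply/coset_piP; move: Zhx; rewrite !invgM !invgK !mulgA.
  move=> [h Sh hx]; rewrite /= -hx translate_pi; exists (a * h)%g.
    exact: SM.
  by rewrite mulgA.
have [mu0|//] := mu_erg mC inv.
exfalso; apply: nE; apply: (@null_sub _ (E `&` (pi @^-1` C) `|`
    [set x | E x /\ ~ forall i, F i x^-1%g = F i x0^-1%g])).
  move=> x Ex; have [Fx|nFx] := pselect (forall i, F i x^-1%g = F i x0^-1%g).
    left; split=> //; apply/orbit_conj_stabilizerP; exists 1%g.
      by have [] := @zpoints_subgroup R n G.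
    by move=> i; rewrite -(F_mul Fx) mulVg.
  by right.
apply: nullU => //; apply: (@negligibleS _ _ _ mu C).
  by move=> _ [x [_ Cx] <-].
by apply/negligibleP.
Qed.

End ReturnTimes.

(** * Algebraic subgroups and the density theorem *)

Section MainTheorem.
Variables (R : realType) (n : nat) (G : Qgroup R n).
Local Open Scope ring_scope.

Lemma algebraic_subgroup_of_polyfun (I : Type) (q : I -> 'M[R]_n.+1 -> R)
    (H : set (rpoints G)) : (forall i, polyfun (q i)) -> is_subgroup H ->
  H = [set x | forall i, q i (mx_of x) = 0] -> algebraic_subgroup H.
Proof.
move=> qP HG HE; split=> //.
exists [set p | exists i, forall g, evalR p g = q i g].
rewrite {1}HE; apply/seteqP; split=> x /= Hx.
  by move=> p [i ->].
by move=> i; have [p pq] := polyfun_evalR_ex (qP i); rewrite -pq; apply: Hx; exists i.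
Qed.

Lemma triangularizable_pos_eigenvalue (a : rpoints G) : triangularizable_pos a ->
  forall l : R[i], eigenvalue (complexify (mx_of a)) l -> 0 < l.
Proof.
move=> [_ a_pos]; apply: (a_pos n.+1 id); split=> // i j.
exists (mpoly.mpolyX _ (mpoly.mnm1 (mxvec_index i j))), 0%N => g _.
by rewrite expr0 divr1 /evalQ mpoly.mmapX mpoly.mmap1U mxvecE.
Qed.

End MainTheorem.

Local Open Scope ereal_scope.

Theorem theorem4 (R : realType) (n : nat) (G : Qgroup R n)
    (noQchar : no_nontrivial_Qcharacter G)
    (a : rpoints G) (a_pos : triangularizable_pos a)
    (mu : probability (borel (homspace G)) R)
    (mu_inv : invariant_measure a mu)
    (mu_erg : ergodic_measure a mu)
    (mu_nc : non_concentrated a mu)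
    (I : set (rpoints G)) (I_fund : fundamental_domain I)
    (E : set (rpoints G)) (EI : E `<=` I)
    (E_meas : measurable (E : set (borel (rpoints G))))
    (E_pos : 0 < lifted_measure mu I E) :
  smallest (@algebraic_subgroup R n G) (return_elements a mu I E) = setT.
Proof.
apply/seteqP; split=> // x _ H [[HG [S HS]] HP]; apply: contrapT => nHx.
have [p Sp px] : exists2 p, S p & evalR p (mx_of x) <> 0%R.
  apply: contrapT => none; apply: nHx; rewrite HS => p Sp.
  by apply: contrapT => px; apply: none; exists p.
have [H1 HM HV] := HG; have [Z1 ZM ZV] := @zpoints_subgroup R n G.
have [||||||J [f [fP fZ fM fH fx]]] := @separating_invariants R n
    (@mx_of R n G @` (H `&` zpoints (G := G))) (evalR p) (mx_of x).
- by exists 1%g.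
- by move=> _ _ [y [Hy Zy] <-] [z [Hz Zz] <-]; exists (y * z)%g;
    split=> //; [exact: HM|exact: ZM].
- move=> _ [y [Hy Zy] <-]; split.
  + exact: mx_of_unit.
  + by case: Zy.
  + by exists (y^-1)%g; split=> //; [exact: HV|exact: ZV].
- exact: polyfun_evalR.
- by move=> _ [y [Hy _] <-]; move: Hy; rewrite HS; apply.
- exact/eqP.
pose F i (y : rpoints G) := f i (mx_of y).
have FM g h : (forall i, F i g = F i h) ->
    forall y i, F i (g * y)%g = F i (h * y)%g.
  by move=> Fgh y i; exact: fM.
have [||||||x0 [Sa mu1]] := @full_orbit R n G a mu mu_inv mu_erg I E EI
    E_meas H HG HP J F.
- by move=> i; exact: continuous_polyfun.
- by move=> i c [cZ _]; exact: fZ.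
- exact: FM.
- by move=> i c Hc Zc; apply: fH; exists c.
- move=> i y; have := posrec_polyfun (triangularizable_pos_eigenvalue a_pos) (mx_of y) (fP i).
  congr posrec; apply/funext => k; congr (f i _).
  elim: k => [|k IHk]; first by rewrite expr0 mulr1 mulg1.
  by rewrite exprSr expgSr mulrA IHk mulgA.
- move=> nE; move: E_pos; rewrite /lifted_measure setIidl // lt0e.
  move=> /andP[/eqP + _]; apply; apply/negligibleP => //.
  exact: measurable_coset_pi.
pose H' := conj_stabilizer F x0.
have H'alg : algebraic_subgroup H'.
  apply: (@algebraic_subgroup_of_polyfun _ _ _ J (fun i g =>
    f i (mx_of (x0^-1)%g * g * mx_of x0) - f i 1)%R).
  - move=> i; apply: polyfunD; last exact: (polyfun_cst _ (- f i 1)%R).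
    exact: polyfun_translate.
  - exact: conj_stabilizer_subgroup.
  - apply/seteqP; split=> y /= Hy i; first by rewrite -[f i 1%R](Hy i) subrr.
    by apply/eqP; rewrite -subr_eq0; apply/eqP; exact: Hy.
have H'T : H' = setT.
  apply: contrapT => nT; have := mu_nc H' H'alg Sa nT x0.
  rewrite mu1 ltxx => nclosed; suff : false by [].
  apply: nclosed; apply: (@closed_orbit_conj_stabilizer R n G J F).
  - by move=> i; exact: continuous_polyfun.
  - by move=> i c [cZ _]; exact: fZ.
  - exact: FM.
apply: fx => i.
have : H' (x0 * x * x0^-1)%g by rewrite H'T.
move=> /(_ i); rewrite !mulgA mulVg mul1g mulgVK; exact.
Qed.
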